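(* Let $(P,\eta,H,M,F)$ be a constrained Hamiltonian system with $\operatorname{rank}(F)=\dim(M)$. If ${}^{\bot}F\cap TM=\{0\}$, then there exists a unique vector field $X\in\mathfrak{X}(M)$ such that, at all points of $M$, $$\flat(X)-\mathrm{d}H+(H+\mathcal{R}(H))\,\eta\in F^{\circ}.$$
   Context: A contact manifold $(P,\eta)$ of dimension $2n+1$ is a manifold with a $1$-form $\eta$ such that $\eta\wedge(\mathrm{d}\eta)^n$ is a volume form. The map $\flat:TP\to T^*P$, $\flat(v)=\iota_v\mathrm{d}\eta+\eta(v)\eta$, is a vector bundle isomorphism with inverse $\sharp$. The Reeb vector field $\mathcal{R}$ is determined by $\iota_{\mathcal{R}}\mathrm{d}\eta=0$, $\eta(\mathcal{R})=1$. A constrained Hamiltonian system $(P,\eta,H,M,F)$ consists of a contact manifold $(P,\eta)$, a smooth function $H:P\to\mathbb{R}$, an embedded submanifold $M\subseteq P$ and a vector subbundle $F$ of $T_MP$ (the restriction of $TP$ to $M$). $F^{\circ}\subseteq T_M^*P$ is the annihilator of $F$, and ${}^{\bot}F=\sharp(F^{\circ})$. Since $F$ is given only along $M$, solutions are considered along $M$, i.e. as vector fields on $M$. *)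

(* Defs.v *)
From HB Require Import structures.
From mathcomp Require Import all_boot all_order all_algebra all_fingroup.
From mathcomp Require Import all_classical all_reals all_analysis.

Set Implicit Arguments.
Unset Strict Implicit.
Unset Printing Implicit Defensive.

Import Order.TTheory GRing.Theory Num.Theory.
Import numFieldNormedType.Exports.

Local Open Scope classical_set_scope.
Local Open Scope ring_scope.

(* C^k on an open set U (Frechet derivatives).  In finite dimension, f is
   C^(k+1) iff it is differentiable and each x |-> Df(x)v is C^k. *)
Fixpoint Cdiff (R : realType) (V W : normedModType R) (k : nat)
    (U : set V) (f : V -> W) : Prop :=
  match k with
  | 0 => forall x, U x -> {for x, continuous f}
  | k'.+1 => (forall x, U x -> differentiable f x) /\
             forall v, Cdiff k' U (fun x => 'd f x v)
  end.

Definition smooth_on (R : realType) (V W : normedModType R)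
    (U : set V) (f : V -> W) : Prop := forall k, Cdiff k U f.

(* The inverse cinv is a total function; its values off the image of cdom are
   irrelevant, as are the values of cmap off cdom. *)
Record chart (R : realType) (T : topologicalType) (m : nat) := Chart {
  cdom : set T;
  cmap : T -> 'rV[R]_m;
  cinv : 'rV[R]_m -> T;
  cdom_open : open cdom;
  cimage_open : open (cmap @` cdom);
  cmapK : forall x, cdom x -> cinv (cmap x) = x;
  cmap_continuous : forall x, cdom x -> {for x, continuous cmap};
  cinv_continuous :
    forall y, (cmap @` cdom) y -> {for y, continuous cinv} }.

Record smooth_structure (R : realType) (T : topologicalType) (m : nat) :=
  SmoothStructure {
  atlas : set (chart R T m);
  atlas_cover : forall x : T, exists c, atlas c /\ cdom c x;
  atlas_compatible : forall c d, atlas c -> atlas d ->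
    smooth_on (cmap c @` (cdom c `&` cdom d)) (cmap d \o cinv c);
  manifold_hausdorff : hausdorff_space T;
  manifold_second_countable : @second_countable T }.

(* A tangent vector at x is represented by its coordinates in the preferred
   chart chart_at x; its coordinates in any other chart c around x are obtained
   from these by the Jacobian of the change of charts (tcoord), with inverse
   tvec.  This is the tangent bundle glued from the cocycle of Jacobians; no
   coherence is required of the choice x |-> chart_at x. *)
Definition tangent (R : realType) (T : topologicalType) (m : nat)
    (S : smooth_structure R T m) (x : T) : vectType R := 'rV[R]_m.

Section Manifold.
Context (R : realType) (T : topologicalType) (m : nat).
Variable S : smooth_structure R T m.

Definition chart_at (x : T) : chart R T m := projT1 (cid (atlas_cover S x)).

Local Notation tangent := (tangent S).

Definition tcoord (c : chart R T m) (x : T) (v : tangent x) : 'rV[R]_m :=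
  'd (cmap c \o cinv (chart_at x)) (cmap (chart_at x) x) v.

Definition tvec (c : chart R T m) (x : T) (u : 'rV[R]_m) : tangent x :=
  'd (cmap (chart_at x) \o cinv c) (cmap c x) u.

Definition smooth_function (f : T -> R) : Prop :=
  forall c, atlas S c ->
    smooth_on (cmap c @` cdom c) (f \o cinv c : _ -> R^o).

Definition differential (f : T -> R) (x : T) (v : tangent x) : R :=
  'd (f \o cinv (chart_at x) : _ -> R^o) (cmap (chart_at x) x) v.

Definition smooth_vector_field (X : forall x, tangent x) : Prop :=
  forall c, atlas S c ->
    smooth_on (cmap c @` cdom c) (fun y => tcoord c (X (cinv c y))).

Definition local_form (eta : forall x, tangent x -> R) (c : chart R T m)
    (y u : 'rV[R]_m) : R :=
  eta (cinv c y) (tvec c (cinv c y) u).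

Definition smooth_one_form (eta : forall x, tangent x -> R) : Prop :=
  (forall x, scalar (eta x)) /\
  forall c, atlas S c -> forall u,
    smooth_on (cmap c @` cdom c) (fun y => local_form eta c y u : R^o).

(* d eta (v, w) = v (eta w) - w (eta v), where v and w are extended to vector
   fields with constant coordinates, whose bracket vanishes. *)
Definition ext_deriv (eta : forall x, tangent x -> R) (x : T)
    (v w : tangent x) : R :=
  let c := chart_at x in
  'd (fun y => local_form eta c y w : R^o) (cmap c x) v -
  'd (fun y => local_form eta c y v : R^o) (cmap c x) w.

End Manifold.

Definition form (R : realType) (k : nat) (V : Type) := ('I_k -> V) -> R.

(* Normalised by 1 / (k! l!), so that the wedge of two 1-forms is
   a(v)b(w) - a(w)b(v). *)
Definition wedge (R : realType) (V : Type) (k l : nat)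
    (a : form R k V) (b : form R l V) : form R (k + l) V :=
  fun v => (k`!%:R * l`!%:R)^-1 *
    \sum_(s : 'S_(k + l))
      (-1) ^+ s * a (fun i => v (s (lshift l i)))
                * b (fun j => v (s (rshift k j))).

Fixpoint wedge_power (R : realType) (V : Type) (b : form R 2 V) (n : nat) :
    form R (n * 2) V :=
  match n with
  | 0 => fun=> 1
  | n'.+1 => wedge b (@wedge_power R V b n')
  end.
Arguments wedge_power {R V} b n.

Definition nowhere_vanishing (R : realType) (T : topologicalType) (m : nat)
    (S : smooth_structure R T m)
    (omega : forall x, form R m (tangent S x)) : Prop :=
  forall x, exists v, omega x v != 0.

Section Contact.
Context (R : realType) (P : topologicalType) (n : nat).
Variable S : smooth_structure R P (1 + n * 2).
Variable eta : forall x, tangent S x -> R.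

(* Smoothness of eta /\ (d eta)^n follows from that of eta, so being a volume
   form amounts to vanishing nowhere. *)
Definition contact_form : Prop :=
  smooth_one_form eta /\
  nowhere_vanishing (fun x =>
    wedge (fun v : 'I_1 -> tangent S x => eta (v ord0))
      (wedge_power (fun v : 'I_2 -> tangent S x =>
         ext_deriv eta (v ord0) (v ord_max)) n)).

Definition flat (x : P) (v : tangent S x) : tangent S x -> R :=
  fun w => ext_deriv eta v w + eta v * eta w.

Definition sharp (x : P) (alpha : tangent S x -> R) : tangent S x :=
  xget 0 [set v | flat v = alpha].

Definition reeb (x : P) : tangent S x :=
  xget 0 [set v | (forall w, ext_deriv eta v w = 0) /\ eta v = 1].

End Contact.

Definition annihilator (R : realType) (V : vectType R) (F : {vspace V}) :
    set (V -> R) :=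
  [set alpha | scalar alpha /\ forall v, v \in F -> alpha v = 0].

Section Maps.
Context (R : realType) (N P : topologicalType) (k m : nat).
Variables (SN : smooth_structure R N k) (SP : smooth_structure R P m).

Definition smooth_map (f : N -> P) : Prop :=
  continuous f /\
  forall c d, atlas SN c -> atlas SP d ->
    smooth_on (cmap c @` (cdom c `&` f @^-1` cdom d))
      (cmap d \o f \o cinv c).

Definition tmap (f : N -> P) (x : N) (v : tangent SN x) : tangent SP (f x) :=
  'd (cmap (chart_at SP (f x)) \o f \o cinv (chart_at SN x))
     (cmap (chart_at SN x) x) v.

Definition immersion (f : N -> P) : Prop :=
  smooth_map f /\ forall x, injective (@tmap f x).

Definition smooth_along (f : N -> P) (V : set N)
    (s : forall x, tangent SP (f x)) : Prop :=
  forall c d, atlas SN c -> atlas SP d ->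
    smooth_on (cmap c @` (cdom c `&` V `&` f @^-1` cdom d))
      (fun y => tcoord d (s (cinv c y))).

(* A rank r subbundle of the pullback of TP along f, given by local smooth
   frames. *)
Definition subbundle (f : N -> P) (r : nat)
    (F : forall x, {vspace tangent SP (f x)}) : Prop :=
  forall x0, exists V : set N, [/\ open V, V x0 &
    exists s : 'I_r -> forall x, tangent SP (f x),
      (forall i, smooth_along V (s i)) /\
      forall x, V x -> basis_of (F x) [seq s i x | i <- enum 'I_r]].

End Maps.

(* M carries the subspace topology (the canonical topology on the type
   associated with M : set P), so an embedding is an immersion here. *)
Definition embedded_submanifold (R : realType) (P : topologicalType)
    (m k : nat) (SP : smooth_structure R P m) (M : set P)
    (SM : smooth_structure R M k) : Prop :=
  immersion SM SP (val : M -> P).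

Definition inclusion_tangent (R : realType) (P : topologicalType)
    (m k : nat) (SP : smooth_structure R P m) (M : set P)
    (SM : smooth_structure R M k) (x : M) (v : tangent SM x) :
    tangent SP (val x) :=
  tmap SP (val : M -> P) v.

(* Main.v *)
From HB Require Import structures.
Require Import Defs.
From mathcomp Require Import all_boot all_order all_algebra all_fingroup.
From mathcomp Require Import all_classical all_reals all_analysis.
From mathcomp Require Import ring.

(** Fix a point x of M.  The map v |-> flat v is injective on the tangent space
    of P: if flat v = 0, evaluation on v itself gives eta(v) = 0, hence
    d eta(v, .) = 0, and a nonzero vector killed by both eta and d eta makes the
    top form eta /\ (d eta)^n vanish ([contact_nondegenerate]).  Consequently the
    transversality hypothesis says that a vector u tangent to M with flat(u) = 0
    on F is zero ([transversal_injective]).  The linear map sending u to the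
    restriction of flat(u) to F goes from the tangent space of M to the dual of
    F; it is injective, and both spaces have dimension k, so it is bijective.
    The required condition says that this map sends X(x) to the restriction of
    dH - (H + R(H)) eta ([solutionP]): there is exactly one candidate X, and only
    its smoothness remains.

    In a chart of M, a chart of P and a local frame s_j of F, the coordinates of
    X solve a square linear system whose matrix has the entries flat(e_i)(s_j).
    By Cramer's rule the solution is smooth as soon as the coefficients are
    ([Cdiff_solve], [solution_smooth]).  The difficulty is that the tangent
    vectors and d eta are given at each point in a preferred chart which varies
    with the point in an uncontrolled way; everything must be rewritten in one
    fixed chart.  For vectors, differentials and 1-forms this is the chain rule
    ([diff_change_chart]).  For d eta it is the naturality of the exterior
    derivative under changes of charts ([extd_pullback]), where the second
    derivatives of the change of charts cancel because they are symmetric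
    ([Clairaut]).

    The Reeb field exists because an antisymmetric bilinear form in odd dimension
    is degenerate; it is smooth by Cramer's rule again, since it is the solution
    of flat(R) = eta ([smooth_reeb]). *)

Set Implicit Arguments.
Unset Strict Implicit.
Unset Printing Implicit Defensive.

Import Order.TTheory GRing.Theory Num.Theory.
Import numFieldNormedType.Exports.

Local Open Scope classical_set_scope.
Local Open Scope ring_scope.

(** * Calculus of maps of class C^k *)

Section Rules.
Context (R : realType) (V W : normedModType R).

(** These rules hold up to conversion for functions given by lambda-abstractions
    and evaluated at a vector, which is how they occur below; as equations between
    functions they would have to be matched against the abstractions. *)
Lemma diffDE (f g : V -> W) x v : differentiable f x -> differentiable g x ->
  'd (fun y => f y + g y) x v = 'd f x v + 'd g x v.
Proof.
by move=> df dg; exact: (congr1 (@^~ v) (diffD df dg)).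
Qed.

Lemma diffME (f g : V -> R^o) x v : differentiable f x -> differentiable g x ->
  'd (fun y => f y * g y : R^o) x v = f x * 'd g x v + g x * 'd f x v.
Proof.
by move=> df dg; exact: (congr1 (@^~ v) (diffM df dg)).
Qed.

Lemma diffVE (f : V -> R^o) x v : differentiable f x -> f x != 0 ->
  'd (fun y => (f y)^-1 : R^o) x v = - ((f x)^-1 * (f x)^-1 * 'd f x v).
Proof.
move=> df f0; rewrite -mulNr -expr2 exprVn.
exact: (congr1 (@^~ v) (diffV df f0)).
Qed.

Lemma diffcE (W' : normedModType R) (f : V -> W) (g : W -> W') x v :
  differentiable f x -> differentiable g (f x) ->
  'd (fun y => g (f y)) x v = 'd g (f x) ('d f x v).
Proof.
by move=> df dg; exact: (congr1 (@^~ v) (diff_comp df dg)).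
Qed.

Lemma diffZE (a : R) (f : V -> R^o) x v : differentiable f x ->
  differentiable (fun y => a * f y : R^o) x /\
  'd (fun y => a * f y : R^o) x v = a * 'd f x v.
Proof.
move=> df; split; first exact: (@differentiableZ _ _ _ f a x df).
exact: (congr1 (@^~ v) (@diffZ _ _ _ f a x df)).
Qed.

End Rules.

Section Germs.
Context (R : realType) (V W : normedModType R).
Implicit Types (f g : V -> W) (x : V).

(** The differential is chosen by an epsilon operator among the linear
    approximations, so that its dependence on the germ alone is not definitional;
    it follows from the uniqueness of the approximation. *)
Lemma near_eq_diff f g x : (\near x, f x = g x) -> differentiable f x ->
  differentiable g x /\ 'd g x = 'd f x :> (V -> W).
Proof.
move=> fg fx; have [fc /eqaddoP fo] := (iffLR (diff_locallyP x f) fx).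
have gxE : g x = f x by rewrite (nbhs_singleton fg).
have go : g \o shift x = cst (g x) + 'd f x +o_ 0 id.
  apply/eqaddoP => e /fo; move: fg; rewrite (near_shift 0) => fg.
  apply: filterS2 fg => h; rewrite /= subr0 /= => fg.
  by rewrite !fctE /= gxE fg.
have dg := diff_unique fc go.
split; last exact: dg.
by apply/diff_locallyP; rewrite dg; split.
Qed.

Lemma Cdiff_sub k (U U' : set V) f : U `<=` U' -> Cdiff k U' f -> Cdiff k U f.
Proof.
move=> UU'; elim: k f => [|k IH] f /=; first by move=> fc x /UU'; exact: fc.
by move=> [fd fk]; split=> [x /UU'|v]; [exact: fd|exact: IH].
Qed.

(** Being of class C^k only involves the germs at the points of U. *)
Lemma Cdiff_local k (U : set V) f :
  (forall x, U x -> exists2 U', U' x & Cdiff k U' f) -> Cdiff k U f.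
Proof.
elim: k f => [|k IH] f /= fU; first by move=> x /fU[U' U'x]; exact.
split=> [x /fU[U' U'x []]|v]; first by move=> + _; exact.
by apply: IH => x /fU[U' U'x [_ fk]]; exists U'.
Qed.

(** Openness of U matters: two functions that agree on U then have the same
    differentials on U, to all orders. *)
Lemma Cdiff_eq k (U : set V) f g : open U -> (forall x, U x -> f x = g x) ->
  Cdiff k U f -> Cdiff k U g.
Proof.
move=> oU; elim: k f g => [|k IH] f g fg.
  move=> fc x Ux; have fgx : {near x, f =1 g}.
    by apply: filterS (open_nbhs_nbhs (conj oU Ux)) => y; exact: fg.
  have := fc x Ux; rewrite /= /prop_for /continuous_at -(fg x Ux).
  move=> fcx; apply: cvg_trans fcx; exact: near_eq_cvg.
have fgx x : U x -> \near x, f x = g x.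
  by move=> Ux; apply: filterS (open_nbhs_nbhs (conj oU Ux)) => y; exact: fg.
move=> [fd fk]; split=> [x Ux|v].
  by have [] := near_eq_diff (fgx x Ux) (fd x Ux).
apply: IH (fk v) => x Ux.
by have [_ ->] := near_eq_diff (fgx x Ux) (fd x Ux).
Qed.

Lemma CdiffW k (U : set V) f : Cdiff k.+1 U f -> Cdiff k U f.
Proof.
elim: k f => [|k IH] f; last first.
  by move=> [fd fk]; split=> // v; apply: IH; exact: fk.
by move=> [fd _] x /fd; exact: differentiable_continuous.
Qed.

Lemma Cdiff_cst k (U : set V) (a : W) : Cdiff k U (fun=> a).
Proof.
elim: k a => [|k IH] a; first by move=> x _; exact: cst_continuous.
split=> [x _|v]; first exact: differentiable_cst.
by rewrite (_ : (fun x => _) = fun=> 0) //; apply/funext => x; rewrite diff_cst.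
Qed.

Lemma Cdiff_add k (U : set V) f g : open U -> Cdiff k U f -> Cdiff k U g ->
  Cdiff k U (fun x => f x + g x).
Proof.
move=> oU; elim: k f g => [|k IH] f g.
  by move=> fc gc x Ux; apply: continuousD; [exact: fc|exact: gc].
move=> [fd fk] [gd gk]; split=> [x Ux|v].
  by apply: differentiableD; [exact: fd|exact: gd].
apply: (Cdiff_eq oU _ (IH _ _ (fk v) (gk v))) => x Ux.
exact/esym/(diffDE v (fd x Ux) (gd x Ux)).
Qed.

Lemma Cdiff_sum k (U : set V) (I : Type) (r : seq I) (P : pred I) (F : I -> V -> W) :
  open U -> (forall i, P i -> Cdiff k U (F i)) ->
  Cdiff k U (fun x => \sum_(i <- r | P i) F i x).
Proof.
move=> oU FU; elim: r => [|i r IH].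
  by under eq_fun do rewrite big_nil; exact: Cdiff_cst.
case Pi: (P i); under eq_fun do rewrite big_cons Pi; last by [].
by apply: Cdiff_add => //; exact: FU.
Qed.

End Germs.

Lemma Cdiff_id (R : realType) (V : normedModType R) k (U : set V) :
  open U -> Cdiff k U (fun x => x).
Proof.
move=> oU; case: k => [|k]; first by move=> x _; exact: cvg_id.
have idd x : is_diff x (id : V -> V) id by exact: is_diff_id.
split=> [x _|v]; first exact: (@ex_diff _ _ _ _ _ _ _ (idd x)).
apply: (Cdiff_eq oU _ (Cdiff_cst k U v)) => x _.
exact: (esym (congr1 (@^~ v) (@diff_val _ _ _ _ _ _ _ (idd x)))).
Qed.

(** A continuous linear map commutes with differentiation. *)
Lemma Cdiff_lincomp (R : realType) (V W W' : normedModType R)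
    (L : {linear W -> W'}) k (U : set V) (f : V -> W) :
  continuous L -> open U -> Cdiff k U f -> Cdiff k U (fun x => L (f x)).
Proof.
move=> Lc oU; elim: k f => [|k IH] f.
  by move=> fc x Ux; apply: continuous_comp; [exact: fc|exact: Lc].
have Ld y : differentiable L y by exact: linear_differentiable.
move=> [fd fk]; split=> [x Ux|v].
  by apply: (@differentiable_comp _ _ _ _ f L); [exact: fd|].
apply: (Cdiff_eq oU _ (IH _ (fk v))) => x Ux.
rewrite (diffcE v (fd x Ux) (Ld _)); congr (_ _); exact/esym/diff_lin.
Qed.

Section ScalarCalculus.
Context (R : realType) (V : normedModType R).
Implicit Types (f g : V -> R^o) (x : V).

Lemma Cdiff_mul k (U : set V) f g : open U -> Cdiff k U f -> Cdiff k U g ->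
  Cdiff k U (fun x => f x * g x : R^o).
Proof.
move=> oU; elim: k f g => [|k IH] f g.
  by move=> fc gc x Ux; apply: continuousM; [exact: fc|exact: gc].
move=> fU gU; have [[fd fk] [gd gk]] := (fU, gU).
split=> [x Ux|v].
  by apply: (@differentiableM _ _ f g); [exact: fd|exact: gd].
have /(Cdiff_eq oU) : forall x, U x ->
    f x * 'd g x v + g x * 'd f x v = 'd (fun x => f x * g x : R^o) x v.
  move=> x Ux.
  exact/esym/(diffME v (fd x Ux) (gd x Ux)).
apply; exact: (Cdiff_add oU (IH _ _ (CdiffW fU) (gk v)) (IH _ _ (CdiffW gU) (fk v))).
Qed.

(** The sum is taken in R, whose additive structure is convertible but not
    syntactically equal to that of R^o. *)
Lemma Cdiff_sumr k (U : set V) (I : Type) (r : seq I) (P : pred I) (F : I -> V -> R^o) :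
  open U -> (forall i, P i -> Cdiff k U (F i)) ->
  Cdiff k U (fun x => \sum_(i <- r | P i) (F i x : R) : R^o).
Proof. exact: Cdiff_sum. Qed.

Lemma Cdiff_prod k (U : set V) (I : Type) (r : seq I) (P : pred I) (F : I -> V -> R^o) :
  open U -> (forall i, P i -> Cdiff k U (F i)) ->
  Cdiff k U (fun x => \prod_(i <- r | P i) F i x : R^o).
Proof.
move=> oU FU; elim: r => [|i r IH].
  by under eq_fun do rewrite big_nil; exact: Cdiff_cst.
case Pi: (P i); under eq_fun do rewrite big_cons Pi; last by [].
by apply: Cdiff_mul => //; exact: FU.
Qed.

Lemma Cdiff_opp k (U : set V) f : open U -> Cdiff k U f ->
  Cdiff k U (fun x => - f x : R^o).
Proof.
move=> oU fU; have -> : (fun x => - f x : R^o) = (fun x => (-1) * f x : R^o).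
  by apply/funext => x; rewrite mulN1r.
by apply: Cdiff_mul => //; exact: Cdiff_cst.
Qed.

(** The derivative of 1/f is - f' (1/f)^2, in which 1/f is of class C^k by
    induction; hence 1/f is of class C^(k+1). *)
Lemma Cdiff_inv k (U : set V) f : open U -> (forall x, U x -> f x != 0) ->
  Cdiff k U f -> Cdiff k U (fun x => (f x)^-1 : R^o).
Proof.
move=> oU f0; elim: k => [|k IH].
  by move=> fc x Ux; apply: continuousV; [exact: f0|exact: fc].
move=> fU; have [fd fk] := fU; have IHU := IH (CdiffW fU).
split=> [x Ux|v].
  by apply: (@differentiableV _ _ f); [exact: fd|exact: f0].
have /(Cdiff_eq oU) : forall x, U x ->
    - ((f x)^-1 * (f x)^-1 * 'd f x v) = 'd (fun x => (f x)^-1 : R^o) x v.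
  move=> x Ux.
  exact/esym/(diffVE v (fd x Ux) (f0 x Ux)).
apply; exact: (Cdiff_opp oU (Cdiff_mul oU (Cdiff_mul oU IHU IHU) (fk v))).
Qed.

End ScalarCalculus.

Section Coordinates.
Context (R : realType) (V : normedModType R).

Lemma coord_linear m (j : 'I_m) : linear (fun u : 'rV[R]_m => u ord0 j : R^o).
Proof. by move=> a u v; rewrite !mxE. Qed.

Lemma Cdiff_coord m k (U : set V) (f : V -> 'rV[R]_m) (j : 'I_m) : open U ->
  Cdiff k U f -> Cdiff k U (fun x => f x ord0 j : R^o).
Proof.
pose L : {linear 'rV[R]_m -> R^o} := HB.pack (fun u : 'rV[R]_m => u ord0 j : R^o)
  (GRing.isLinear.Build _ _ _ _ _ (coord_linear j)).
have Lc : continuous L by exact: coord_continuous.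
exact: (Cdiff_lincomp Lc).
Qed.

Lemma diff_coordE m (f : V -> 'rV[R]_m) (j : 'I_m) x v : differentiable f x ->
  'd (fun y => f y ord0 j : R^o) x v = 'd f x v ord0 j.
Proof.
pose L : {linear 'rV[R]_m -> R^o} := HB.pack (fun u : 'rV[R]_m => u ord0 j : R^o)
  (GRing.isLinear.Build _ _ _ _ _ (coord_linear j)).
have Lc : continuous L by exact: coord_continuous.
move=> fd; apply: (etrans (diffcE v fd (linear_differentiable (f x) Lc))).
exact: (congr1 (@^~ ('d f x v)) (diff_lin (f x) Lc)).
Qed.

(** A vector is the sum of its coordinates times the basis vectors, and
    each a |-> a *: e_j is linear. *)
Lemma Cdiff_row m k (U : set V) (f : V -> 'rV[R]_m) : open U ->
  (forall j, Cdiff k U (fun x => f x ord0 j : R^o)) -> Cdiff k U f.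
Proof.
move=> oU fU.
have /(Cdiff_eq oU) : forall x, U x ->
    \sum_j f x ord0 j *: delta_mx ord0 j = f x by move=> x _; rewrite -row_sum_delta.
apply; apply: Cdiff_sum => // j _.
pose e : 'rV[R]_m := delta_mx ord0 j.
have Llin : linear (fun a : R^o => a *: e).
  by move=> a u v; rewrite scalerDl scalerA.
pose LM := GRing.isLinear.Build _ _ _ _ _ Llin.
pose L : {linear R^o -> 'rV[R]_m} := HB.pack (fun a : R^o => a *: e) LM.
have Lc : continuous L by move=> a; exact: scalel_continuous.
exact: (Cdiff_lincomp Lc oU (fU j)).
Qed.

End Coordinates.

Section Composition.
Context (R : realType) (V : normedModType R) (m : nat).

(** Faa di Bruno by induction: the derivative of g o f in the direction v
    is the sum over j of (Df v)_j times (D_j g) o f, in which D_j g is again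
    composed with f but is only of class C^k. *)
Lemma Cdiff_comp_scalar k (U : set V) (U' : set 'rV[R]_m) (f : V -> 'rV[R]_m)
    (g : 'rV[R]_m -> R^o) : open U -> (forall x, U x -> U' (f x)) ->
  Cdiff k U f -> Cdiff k U' g -> Cdiff k U (fun x => g (f x)).
Proof.
move=> oU fUU'; elim: k g => [|k IH] g.
  move=> fc gc x Ux; apply: continuous_comp; first exact: fc.
  by apply: gc; exact: fUU'.
move=> fU [gd gk]; have [fd fk] := fU.
split=> [x Ux|v].
  by apply: (@differentiable_comp _ _ _ _ f g); [exact: fd|apply: gd; exact: fUU'].
have /(Cdiff_eq oU) : forall x, U x ->
    \sum_j 'd f x v ord0 j * 'd g (f x) (delta_mx ord0 j) =
    'd (fun x => g (f x)) x v.
  move=> x Ux; rewrite (diffcE v (fd x Ux) (gd _ (fUU' x Ux))).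
  rewrite [in RHS](row_sum_delta ('d f x v)) linear_sum.
  by apply: eq_bigr => j _; rewrite linearZ.
apply; apply: (@Cdiff_sumr R V k U _ _ _ _ oU) => j _; apply: (Cdiff_mul oU).
  exact: (Cdiff_coord _ oU (fk v)).
exact: (IH _ (CdiffW fU) (gk _)).
Qed.

Lemma Cdiff_comp l k (U : set V) (U' : set 'rV[R]_m) (f : V -> 'rV[R]_m)
    (g : 'rV[R]_m -> 'rV[R]_l) : open U -> open U' -> (forall x, U x -> U' (f x)) ->
  Cdiff k U f -> Cdiff k U' g -> Cdiff k U (fun x => g (f x)).
Proof.
move=> oU oU' fUU' fU gU; apply: Cdiff_row => // j.
exact: (Cdiff_comp_scalar oU fUU' fU (Cdiff_coord j oU' gU)).
Qed.

End Composition.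

Section LinearSystem.
Context (R : realType) (V : normedModType R).

Lemma Cdiff_det l k (U : set V) (A : V -> 'M[R]_l) : open U ->
  (forall i j, Cdiff k U (fun x => A x i j : R^o)) ->
  Cdiff k U (fun x => \det (A x) : R^o).
Proof.
move=> oU AU; apply: (@Cdiff_sumr R V k U _ _ _ _ oU) => s _; apply: (Cdiff_mul oU).
  exact: Cdiff_cst.
by apply: (@Cdiff_prod R V k U _ _ _ (fun i x => A x i (s i)) oU) => i _; exact: AU.
Qed.

(** Cramer's rule: the coefficients of the inverse matrix are cofactors
    divided by the determinant, so rational functions of the entries. *)
Lemma Cdiff_solve l k (U : set V) (A : V -> 'M[R]_l) (b x : V -> 'rV[R]_l) :
  open U -> (forall i j, Cdiff k U (fun y => A y i j : R^o)) ->
  (forall j, Cdiff k U (fun y => b y ord0 j : R^o)) ->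
  (forall y, U y -> A y \in unitmx) ->
  (forall y, U y -> x y *m A y = b y) -> Cdiff k U x.
Proof.
move=> oU AU bU Au xA; apply: Cdiff_row => // j.
have /(Cdiff_eq oU) : forall y, U y ->
    \sum_i b y ord0 i * ((\det (A y))^-1 * cofactor (A y) j i) = x y ord0 j.
  move=> y Uy; rewrite -[in RHS](mulmxK (Au y Uy) (x y)) (xA y Uy) mxE.
  by apply: eq_bigr => i _; rewrite /invmx (Au y Uy) !mxE.
apply; apply: (@Cdiff_sumr R V k U _ _ _ _ oU) => i _.
apply: (Cdiff_mul oU); first exact: bU.
apply: (Cdiff_mul oU).
  apply: (Cdiff_inv oU); last exact: Cdiff_det.
  by move=> y /Au; rewrite unitmxE unitfE.
apply: (Cdiff_mul oU); first exact: Cdiff_cst.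
apply: (Cdiff_det oU) => i' j'; under eq_fun do rewrite !mxE; exact: AU.
Qed.

End LinearSystem.

(** * Symmetry of second derivatives and the exterior derivative in coordinates *)

Section Clairaut.
Context (R : realType) (V : normedModType R).
Implicit Types (f g : V -> R^o) (x u v : V).

Lemma MVT_line f x u (h : R) : 0 < h ->
  (forall t, 0 <= t <= h -> differentiable f (x + t *: u)) ->
  exists2 c, 0 < c < h & f (x + h *: u) - f x = 'd f (x + c *: u) u * h.
Proof.
move=> h0 fd.
pose l (t : R^o) : V := x + t *: u.
have ld (t : R) : differentiable l t /\ 'd l t (1 : R^o) = u.
  have dZ : is_diff t ( *:%R ^~ u : R^o -> V) ( *:%R ^~ u) by exact: is_diff_scalel.
  have dl : differentiable ( *:%R ^~ u : R^o -> V) t by exact: ex_diff.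
  have dc : differentiable (cst x : R^o -> V) t by exact: differentiable_cst.
  split; first exact: (differentiableD dc dl).
  rewrite (diffDE _ dc dl) diff_cst add0r.
  by rewrite [LHS](congr1 (@^~ 1) (@diff_val _ _ _ _ _ _ _ dZ)) scale1r.
have fld (t : R) : 0 <= t <= h -> differentiable (f \o l : R^o -> R^o) t.
  by move=> th; apply: differentiable_comp; [case: (ld t)|exact: fd].
have [||c] := @MVT R (f \o l) (fun t => 'd f (l t) u) 0 h h0.
- move=> t; rewrite in_itv/= => /andP[t0 th].
  have tI : 0 <= t <= h by rewrite !ltW.
  apply: DeriveDef; first exact/derivable1_diffP/fld.
  rewrite (deriveE _ (fld t tI)) (diffcE _ (proj1 (ld t)) (fd t tI)).
  by rewrite (proj2 (ld t)).
- apply: continuous_in_subspaceT => t; rewrite inE/= in_itv/= => tI.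
  exact/differentiable_continuous/fld.
rewrite in_itv/= => cI; rewrite /l /= scale0r addr0 subr0 => fE.
by exists c.
Qed.

(** The mean value theorem twice: in the direction u for the difference
    y |-> f(y + h v) - f(y), then in the direction v for the derivative of f along
    u.  The left hand side is symmetric in u and v, the right hand side is a
    mixed second derivative; comparing both orders gives the symmetry. *)
Lemma second_difference (U : set V) f x u v (h : R) : 0 < h -> Cdiff 2 U f ->
  (forall s t, 0 <= s <= h -> 0 <= t <= h -> U (x + s *: u + t *: v)) ->
  exists s t, [/\ 0 < s < h, 0 < t < h &
    f (x + h *: u + h *: v) - f (x + h *: u) - f (x + h *: v) + f x =
    'd (fun y => 'd f y u : R^o) (x + s *: u + t *: v) v * h * h].
Proof.
move=> h0 [fd fk] xU.
have hh : 0 <= h <= h by apply/andP; split; [exact: ltW|exact: lexx].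
have h00 : 0 <= (0 : R) <= h by apply/andP; split; [exact: lexx|exact: ltW].
have xU0 s : 0 <= s <= h -> U (x + s *: u).
  by move=> sI; have := xU s 0 sI h00; rewrite scale0r addr0.
pose sh (y : V) : V := y + h *: v.
have shd y : differentiable sh y /\ forall w, 'd sh y w = w.
  have d1 : differentiable (id : V -> V) y by exact: ex_diff.
  have d2 : differentiable (cst (h *: v) : V -> V) y by exact: differentiable_cst.
  split; first exact: (differentiableD d1 d2).
  move=> w; rewrite (diffDE _ d1 d2) diff_cst addr0.
  by rewrite [LHS](congr1 (@^~ w) (@diff_val _ _ _ _ _ _ _ (is_diff_id y))).
have fsd s : 0 <= s <= h -> differentiable (f \o sh) (x + s *: u).
  move=> sI; apply: differentiable_comp; first by case: (shd (x + s *: u)).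
  exact/fd/xU.
have fnd s : 0 <= s <= h -> differentiable (fun y => - f y : R^o) (x + s *: u).
  by move=> sI; apply: (@differentiableN _ _ _ f); exact/fd/xU0.
have [s sI phiE] := @MVT_line (fun y => f (sh y) + - f y) x u h h0
  (fun s sI => differentiableD (fsd s sI) (fnd s sI)).
have sI' : 0 <= s <= h by case/andP: sI => *; rewrite !ltW.
have [t tI psiE] := @MVT_line (fun y => 'd f y u : R^o) (x + s *: u) v h h0
  (fun t tI => proj1 (fk u) _ (xU s t sI' tI)).
exists s, t; split=> //.
rewrite -psiE.
have dN : 'd (fun y => - f y : R^o) (x + s *: u) u = - 'd f (x + s *: u) u.
  exact: (congr1 (@^~ u) (diffN (fd _ (xU0 s sI')))).
have dS : 'd (fun y => f (sh y) : R^o) (x + s *: u) u = 'd f (x + s *: u + h *: v) u.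
  have [d1 d2] := shd (x + s *: u).
  by rewrite (diffcE _ d1 (fd _ (xU s h sI' hh))) d2.
have dE := etrans (diffDE u (fsd s sI') (fnd s sI')) (congr2 +%R dS dN).
move: (etrans phiE (congr1 ( *%R^~ h) dE)) => <-.
by rewrite /sh; ring.
Qed.

(** By [second_difference] the two mixed derivatives take a common value at
    points arbitrarily close to x, not necessarily at the same ones; by continuity
    they agree at x. *)
Lemma Clairaut (U : set V) f x u v : open U -> U x -> Cdiff 2 U f ->
  'd (fun y => 'd f y u : R^o) x v = 'd (fun y => 'd f y v : R^o) x u.
Proof.
move=> oU Ux fU.
pose D u v y : R := 'd (fun y => 'd f y u : R^o) y v.
have Dc a b : {for x, continuous (D a b)}.
  by have [_ /(_ a)[_ /(_ b)]] := fU; apply.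
change (D u v x = D v u x); apply/eqP; rewrite -subr_eq0 -normr_le0.
apply/ler_addgt0Pl => e e0; rewrite addr0.
have e20 : 0 < e / 2 by rewrite divr_gt0.
have : \forall y \near x, [/\ `|D u v x - D u v y| < e / 2,
    `|D v u x - D v u y| < e / 2 & U y].
  have /cvgrPdist_lt/(_ _ e20) n1 := Dc u v.
  have /cvgrPdist_lt/(_ _ e20) n2 := Dc v u.
  near=> y; split; first by near: y; exact: n1.
    by near: y; exact: n2.
  by near: y; exact: (open_nbhs_nbhs (conj oU Ux)).
move=> /nbhs_normP[r /= r0 xr].
(* h is such that every point of the parallelogram is within r of x *)
pose N := `|u| + `|v| + 1; have N0 : 0 < N by rewrite ltr_wpDl// addr_ge0.
pose h := r / N; have h0 : 0 < h by rewrite divr_gt0.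
have hN : h * N = r by rewrite /h divfK// gt_eqF.
have inb s t a b : (`|a| + `|b| + 1 = N) -> 0 <= s <= h -> 0 <= t <= h ->
    `|x - (x + s *: a + t *: b)| < r.
  move=> abN /andP[s0 sh] /andP[t0 th]; rewrite -hN -abN -addrA opprD addNKr normrN.
  apply: (@le_lt_trans _ _ (s * `|a| + t * `|b|)).
    apply: (le_trans (ler_normD _ _)).
    by rewrite !normrZ (ger0_norm s0) (ger0_norm t0).
  rewrite 2!mulrDr mulr1 ltr_pwDr// lerD//; exact: ler_wpM2r.
have abN : `|u| + `|v| + 1 = N by [].
have baN : `|v| + `|u| + 1 = N by rewrite [`|v| + _]addrC.
have [s [t [sI tI E1]]] := @second_difference U f x u v h h0 fU
  (fun s t sI tI => let: And3 _ _ Uy := xr _ (inb s t _ _ abN sI tI) in Uy).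
have [s' [t' [sI' tI' E2]]] := @second_difference U f x v u h h0 fU
  (fun s t sI tI => let: And3 _ _ Uy := xr _ (inb s t _ _ baN sI tI) in Uy).
have W c : 0 < c < h -> 0 <= c <= h by case/andP=> *; rewrite !ltW.
have [d1 _ _] := xr _ (inb _ _ _ _ abN (W _ sI) (W _ tI)).
have [_ d2 _] := xr _ (inb _ _ _ _ baN (W _ sI') (W _ tI')).
have DE : D u v (x + s *: u + t *: v) = D v u (x + s' *: v + t' *: u).
  apply: (mulIf (lt0r_neq0 h0)); apply: (mulIf (lt0r_neq0 h0)).
  rewrite /D -E1 -E2 [x + h *: v + _]addrAC; ring.
move: d1 d2; rewrite DE; set a := D u v x; set b := D v u x; set c := D v u _.
move=> d1 d2; rewrite (_ : a - b = (a - c) - (b - c)); last by ring.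
apply: (le_trans (ler_normB _ _)).
by apply: ltW; rewrite (splitr e) ltrD.
Unshelve. all: by end_near. Qed.

End Clairaut.

Section ExteriorDerivative.
Context (R : realType) (m : nat).
Implicit Types (e : 'rV[R]_m -> 'rV[R]_m -> R) (y u v w : 'rV[R]_m).

(** The coordinate expression of the exterior derivative of the 1-form e, on
    vector fields with constant coordinates. *)
Definition extd e y v w : R :=
  'd (fun z => e z w : R^o) y v - 'd (fun z => e z v : R^o) y w.

Lemma diff_sumE (V : normedModType R) (I : Type) (r : seq I) (F : I -> V -> R^o) (y v : V) :
  (forall i, differentiable (F i) y) ->
  differentiable (fun z => \sum_(i <- r) (F i z : R) : R^o) y /\
  'd (fun z => \sum_(i <- r) (F i z : R) : R^o) y v = \sum_(i <- r) ('d (F i) y v : R).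
Proof.
move=> Fd; elim: r => [|i r [IHd IHE]].
  under eq_fun do rewrite big_nil; rewrite big_nil.
  by split; [exact: differentiable_cst|rewrite diff_cst].
under eq_fun do rewrite big_cons; rewrite big_cons.
split; first exact: (differentiableD (Fd i) IHd).
by rewrite -IHE; exact: (diffDE v (Fd i) IHd).
Qed.

Lemma form_sum e y u : scalar (e y) ->
  e y u = \sum_j u ord0 j * e y (delta_mx ord0 j).
Proof.
move=> el.
pose L : {scalar 'rV[R]_m} := HB.pack (e y) (GRing.isLinear.Build _ _ _ _ _ el).
rewrite -[e y u]/(L u) {1}(row_sum_delta u) linear_sum.
by apply: eq_bigr => j _; rewrite linearZ.
Qed.

Lemma diff_form_sum (U : set 'rV[R]_m) e y u v : open U -> U y ->
  (forall z, U z -> scalar (e z)) ->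
  (forall w, differentiable (fun z => e z w : R^o) y) ->
  'd (fun z => e z u : R^o) y v =
  \sum_j u ord0 j * 'd (fun z => e z (delta_mx ord0 j) : R^o) y v.
Proof.
move=> oU Uy el ed.
pose F j := (fun z => u ord0 j * e z (delta_mx ord0 j) : R^o).
have Fd j : differentiable (F j) y /\
    'd (F j) y v = u ord0 j * 'd (fun z => e z (delta_mx ord0 j) : R^o) y v.
  exact: diffZE.
have [sd sE] := diff_sumE (index_enum 'I_m) v (fun j => proj1 (Fd j)).
rewrite (_ : \sum_j _ = \sum_j 'd (F j) y v); last first.
  by apply: eq_bigr => j _; exact: esym (proj2 (Fd j)).
rewrite -sE; apply: (congr1 (@^~ v)); apply: (proj2 (near_eq_diff _ sd)).
apply: filterS (open_nbhs_nbhs (conj oU Uy)) => z Uz.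
by rewrite [RHS](form_sum _ (el z Uz)).
Qed.

(** The exterior derivative commutes with pull-back: here e' is the pull-back
    of e by t.  Differentiating e(t z)(Dt w) produces, besides the expected term,
    e applied to the second derivative of t; the latter is symmetric and
    disappears in the antisymmetrisation. *)
Lemma extd_pullback (U U' : set 'rV[R]_m) e e' (t : 'rV[R]_m -> 'rV[R]_m) y v w :
  open U -> open U' -> (forall z, U z -> U' (t z)) -> smooth_on U t ->
  (forall z, U' z -> scalar (e z)) ->
  (forall u, smooth_on U' (fun z => e z u : R^o)) ->
  (forall z u, U z -> e' z u = e (t z) ('d t z u)) -> U y ->
  extd e' y v w = extd e (t y) ('d t y v) ('d t y w).
Proof.
move=> oU oU' tU tS el eS e'E Uy.
have tkd j a : differentiable (fun z => 'd t z a ord0 j : R^o) y.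
  have [_ /(_ a) tk] := tS 2%N.
  by have [+ _] := @Cdiff_coord R _ m 1 U _ j oU tk; exact.
have td : differentiable t y by have [+ _] := tS 1%N; exact.
have ed j z : U' z -> differentiable (fun z => e z j : R^o) z.
  by have [+ _] := eS j 1%N; exact.
have eqd j : differentiable (fun z => e (t z) (delta_mx ord0 j) : R^o) y.
  by apply: (@differentiable_comp _ _ _ _ t (fun z => e z (delta_mx ord0 j) : R^o));
    [|exact/ed/tU].
have main a b : 'd (fun z => e' z b : R^o) y a =
    \sum_j ('d t y b ord0 j *
        'd (fun z => e z (delta_mx ord0 j) : R^o) (t y) ('d t y a) +
      e (t y) (delta_mx ord0 j) * 'd (fun z => 'd t z b ord0 j : R^o) y a).
  pose F j := (fun z => 'd t z b ord0 j * e (t z) (delta_mx ord0 j) : R^o).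
  have Fd j : differentiable (F j) y by exact: (differentiableM (tkd j b) (eqd j)).
  have [sd sE] := diff_sumE (index_enum 'I_m) a Fd.
  transitivity ('d (fun z => \sum_j (F j z : R) : R^o) y a).
    apply: (congr1 (@^~ a)); apply: (proj2 (near_eq_diff _ sd)).
    apply: filterS (open_nbhs_nbhs (conj oU Uy)) => z Uz.
    by rewrite (e'E z b Uz) [RHS](form_sum _ (el _ (tU z Uz))).
  apply: (etrans sE); apply: eq_bigr => j _.
  have cE : 'd (fun z => e (t z) (delta_mx ord0 j) : R^o) y a =
      'd (fun z => e z (delta_mx ord0 j) : R^o) (t y) ('d t y a).
    exact: (diffcE a td (ed (delta_mx ord0 j) _ (tU y Uy))).
  exact: (etrans (diffME a (tkd j b) (eqd j))
    (congr1 (fun r => 'd t y b ord0 j * r + e (t y) (delta_mx ord0 j) *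
       'd (fun z => 'd t z b ord0 j : R^o) y a) cE)).
have sym j a b : 'd (fun z => 'd t z b ord0 j : R^o) y a =
                 'd (fun z => 'd t z a ord0 j : R^o) y b.
  have tj c z : U z -> 'd t z c ord0 j = 'd (fun z => t z ord0 j : R^o) z c.
    by move=> Uz; have [tz _] := tS 1%N; rewrite (diff_coordE _ _ (tz z Uz)).
  have tjE c : 'd (fun z => 'd t z c ord0 j : R^o) y =
      'd (fun z => 'd (fun z => t z ord0 j : R^o) z c : R^o) y :> (_ -> _).
    apply/esym; apply: (proj2 (near_eq_diff _ (tkd j c))).
    by apply: filterS (open_nbhs_nbhs (conj oU Uy)) => z; exact: tj.
  have tj2 := @Cdiff_coord R _ m 2 U t j oU (tS 2%N).
  exact: (etrans (congr1 (@^~ a) (tjE b)) (etrans (Clairaut b a oU Uy tj2)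
    (esym (congr1 (@^~ b) (tjE a))))).
have lin a b := diff_form_sum b a oU' (tU y Uy) el (fun w => ed w _ (tU y Uy)).
apply: (etrans (congr2 (fun p q : R => p - q) (main v w) (main w v))).
apply/esym/(etrans (congr2 (fun p q : R => p - q) (lin _ _) (lin _ _))).
rewrite -!sumrB; apply: eq_bigr => j _.
have cancel (a b p q c s s' : R) : s = s' ->
    a * p - b * q = (a * p + c * s) - (b * q + c * s').
  by move=> ->; rewrite opprD addrACA subrr addr0.
exact: (cancel _ _ _ _ _ _ _ (sym j v w)).
Qed.

End ExteriorDerivative.

(** * Linear algebra of contact forms *)

Section Forms.
Context (R : realType) (V : lmodType R).

Definition update k (v : 'I_k -> V) (i : 'I_k) (u : V) : 'I_k -> V :=
  fun j => if j == i then u else v j.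

Definition multilinear k (a : Defs.form R k V) : Prop :=
  forall v i, scalar (fun u => a (update v i u)).

Definition in_radical k (w : V) (a : Defs.form R k V) : Prop :=
  forall v i, v i = w -> a v = 0.

Lemma update_inj k l (f : 'I_l -> 'I_k) (v : 'I_k -> V) j u : injective f ->
  (fun i => update v (f j) u (f i)) = update (fun i => v (f i)) j u.
Proof. by move=> fI; apply/funext => i; rewrite /update (inj_eq fI). Qed.

Lemma update_notin k l (f : 'I_l -> 'I_k) (v : 'I_k -> V) i u :
  (forall j, f j != i) -> (fun j => update v i u (f j)) = (fun j => v (f j)).
Proof. by move=> fi; apply/funext => j; rewrite /update (negbTE (fi j)). Qed.

(** In a term of a wedge product each slot feeds exactly one of the two
    factors. *)
Lemma perm_shiftP k l (s : 'S_(k + l)) i :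
  (exists2 j, i = s (lshift l j) & forall j', s (rshift k j') != i) \/
  (exists2 j, i = s (rshift k j) & forall j', s (lshift l j') != i).
Proof.
rewrite -[i](permKV s); case: (splitP (s^-1%g i)) => j ij.
  have -> : (s^-1)%g i = lshift l j by exact: val_inj.
  by left; exists j => // j'; rewrite (inj_eq perm_inj) eq_sym eq_lrshift.
have -> : (s^-1)%g i = rshift k j by exact: val_inj.
by right; exists j => // j'; rewrite (inj_eq perm_inj) eq_lrshift.
Qed.

Lemma wedge_multilinear k l (a : Defs.form R k V) (b : Defs.form R l V) :
  multilinear a -> multilinear b -> multilinear (wedge a b).
Proof.
move=> aL bL v i c u1 u2; rewrite /wedge mulrCA -mulrDr; congr (_ * _).
rewrite mulr_sumr -big_split; apply: eq_bigr => s _ /=.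
have injl : injective (fun j => s (lshift l j)).
  by apply: inj_comp perm_inj _; exact: lshift_inj.
have injr : injective (fun j => s (rshift k j)).
  by apply: inj_comp perm_inj _; exact: rshift_inj.
have [[j -> jr]|[j -> jl]] := perm_shiftP s i.
  rewrite !(update_inj _ _ _ injl) !(update_notin _ _ jr).
  by rewrite aL mulrDr mulrDl !mulrA; congr (_ * _ * _ + _); exact: mulrC.
rewrite !(update_inj _ _ _ injr) !(update_notin _ _ jl).
by rewrite bL mulrDr !mulrA; congr (_ * _ + _); rewrite mulrC mulrA.
Qed.

Lemma wedge_radical k l (a : Defs.form R k V) (b : Defs.form R l V) w :
  in_radical w a -> in_radical w b -> in_radical w (wedge a b).
Proof.
move=> aw bw v i vi; rewrite /wedge big1 ?mulr0// => s _.
have [[j ij _]|[j ij _]] := perm_shiftP s i; rewrite ij in vi.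
  by rewrite (aw _ _ vi) mulr0 mul0r.
by rewrite (bw _ _ vi) mulr0.
Qed.

(** Composing the summation index with the transposition of i and j changes
    the sign of every term and nothing else, so the sum is its own opposite. *)
Lemma wedge_alternating k l (a : Defs.form R k V) (b : Defs.form R l V) v i j :
  i != j -> v i = v j -> wedge a b v = 0.
Proof.
move=> ij vij; rewrite /wedge; set S := \sum_s _.
suff SE : S = - S.
  have /eqP : S *+ 2 = 0 by rewrite mulr2n {2}SE subrr.
  by rewrite mulrn_eq0 => /eqP ->; rewrite mulr0.
have vt x : v (tperm i j x) = v x by case: tpermP => // ->.
rewrite {1}/S (reindex_inj (mulIg (tperm i j))) /= -sumrN; apply: eq_bigr => s _.
rewrite odd_permM odd_tperm ij addbT signrN !mulNr; congr (- (_ * _ * _)).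
  by congr (a _); apply/funext => x; rewrite permM vt.
by congr (b _); apply/funext => x; rewrite permM vt.
Qed.

Lemma wedge_power_multilinear (b : Defs.form R 2 V) n :
  multilinear b -> multilinear (wedge_power b n).
Proof.
move=> bL; elim: n => [|n IH]; first by move=> v [].
exact: wedge_multilinear.
Qed.

Lemma wedge_power_radical (b : Defs.form R 2 V) n w :
  in_radical w b -> in_radical w (wedge_power b n).
Proof.
move=> bw; elim: n => [|n IH]; first by move=> v [].
exact: wedge_radical.
Qed.

End Forms.

(** If the m vectors v_j are independent, w is a combination of them;
    otherwise 0 is a nontrivial one.  Either way a combination with some c_i
    nonzero is killed when put in the slot i, while by multilinearity and
    alternation its value there is c_i times a(v). *)
Lemma top_form_radical (R : realType) m (a : Defs.form R m 'rV[R]_m) (w : 'rV[R]_m) :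
  multilinear a -> (forall v i j, i != j -> v i = v j -> a v = 0) ->
  in_radical w a -> w != 0 -> forall v, a v = 0.
Proof.
move=> aL aA aw w0 v.
pose W : 'M[R]_m := \matrix_i v i.
have vE u : u *m W = \sum_j u ord0 j *: v j.
  by rewrite mulmx_sum_row; apply: eq_bigr => j _; rewrite rowK.
(* the row c holds the coefficients of the combination *)
have [c c0 cW] : exists2 c : 'rV[R]_m, c != 0 & (c *m W == 0) || (c *m W == w).
  have [Wu|Wn] := boolP (W \in unitmx).
    exists (w *m invmx W); last by rewrite mulmxKV// eqxx orbT.
    by apply: contraNneq w0 => /(congr1 (mulmx^~ W)); rewrite mulmxKV// mul0mx => ->.
  move: Wn; rewrite unitmxE unitfE negbK => /det0P[c c0 cW].
  by exists c; rewrite // cW eqxx.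
have [i ci] : exists i, c ord0 i != 0.
  apply/existsP; apply: contraNT c0; rewrite negb_exists => /forallP cz.
  by apply/eqP/rowP => j; rewrite mxE; apply/eqP; have := cz j; rewrite negbK.
pose L : {scalar 'rV[R]_m} := HB.pack (fun u => a (update v i u))
  (GRing.isLinear.Build _ _ _ _ _ (aL v i)).
have L0 : L (c *m W) = 0.
  case/orP: cW => /eqP ->; first exact: linear0.
  by apply: (aw _ i); rewrite /update eqxx.
have : L (c *m W) = c ord0 i * a v.
  rewrite vE linear_sum (bigD1 i)// big1 => [|j ji].
    rewrite linearZ /= addr0; apply: (congr1 (fun x => c ord0 i * a x)).
    apply/funext => j; rewrite /update.
    by case: eqP => [->|].
  have {}ji : j != i := ji.
  rewrite linearZ /= (aA _ i j) ?mulr0//; first by rewrite eq_sym.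
  by rewrite /update eqxx (negbTE ji).
rewrite L0 => /esym/eqP; rewrite mulf_eq0 (negbTE ci) /=.
by move/eqP.
Qed.

Section ContactAlgebra.
Context (R : realType) (m : nat) (a : 'rV[R]_m -> R) (b : 'rV[R]_m -> 'rV[R]_m -> R).
Hypotheses (aL : scalar a) (bLl : forall w, scalar (b^~ w)) (bLr : forall v, scalar (b v)).

(** The degeneracy of b, the surjectivity of its adjoint and the smoothness of
    solutions are all read on this matrix. *)
Lemma bilinear_matrix (u w : 'rV[R]_m) :
  b u w = (u *m (\matrix_(i, j) b (delta_mx ord0 i) (delta_mx ord0 j)) *m w^T) ord0 ord0.
Proof.
pose Lr v : {scalar 'rV[R]_m} := HB.pack (b v) (GRing.isLinear.Build _ _ _ _ _ (bLr v)).
pose Ll v : {scalar 'rV[R]_m} := HB.pack (b^~ v) (GRing.isLinear.Build _ _ _ _ _ (bLl v)).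
rewrite -[LHS]/(Lr u w) {1}(row_sum_delta w) linear_sum [RHS]mxE; apply: eq_bigr => j _.
rewrite linearZ !mxE [RHS]mulrC; congr (_ * _).
rewrite -[LHS]/(Ll _ u) {1}(row_sum_delta u) linear_sum; apply: eq_bigr => i _.
by rewrite linearZ mxE.
Qed.

Lemma bilinear_unit : (forall v, (forall w, b v w = 0) -> v = 0) ->
  \matrix_(i, j) b (delta_mx ord0 i) (delta_mx ord0 j) \in unitmx.
Proof.
move=> b0; rewrite unitmxE unitfE; apply/det0P => -[v v0 vB].
by case/eqP: v0; apply: b0 => w; rewrite bilinear_matrix vB mul0mx mxE.
Qed.

Lemma bilinear_surj : (forall v, (forall w, b v w = 0) -> v = 0) ->
  forall al : 'rV[R]_m -> R, scalar al -> exists v, forall w, b v w = al w.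
Proof.
move=> b0 al alL; have Bu := bilinear_unit b0.
pose A : {scalar 'rV[R]_m} := HB.pack al (GRing.isLinear.Build _ _ _ _ _ alL).
exists ((\row_j al (delta_mx ord0 j)) *m invmx
  (\matrix_(i, j) b (delta_mx ord0 i) (delta_mx ord0 j))) => w.
rewrite bilinear_matrix mulmxKV// -[RHS]/(A w) {2}(row_sum_delta w) linear_sum mxE.
by apply: eq_bigr => j _; rewrite linearZ !mxE mulrC.
Qed.

Hypothesis (bA : forall v w, b v w = - b w v).

(** In odd dimension the determinant of an antisymmetric matrix is its own
    opposite. *)
Lemma odd_antisymmetric_degenerate : odd m ->
  exists2 v : 'rV[R]_m, v != 0 & forall w, b v w = 0.
Proof.
move=> modd; pose B : 'M[R]_m := \matrix_(i, j) b (delta_mx ord0 i) (delta_mx ord0 j).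
have /eqP/det0P[v v0 vB] : \det B = 0.
  have BT : B^T = -1 *: B by apply/matrixP => i j; rewrite !mxE mulN1r; exact: bA.
  have := det_tr B; rewrite BT detZ -signr_odd modd expr1 mulN1r => /eqP.
  by rewrite eq_sym -subr_eq0 opprK -mulr2n mulrn_eq0 => /eqP.
by exists v => // w; rewrite bilinear_matrix vB mul0mx mxE.
Qed.

Hypothesis nondeg : forall v, a v = 0 -> (forall w, b v w = 0) -> v = 0.

(** Evaluation on v itself kills the antisymmetric part and leaves the
    square of a(v). *)
Lemma flat_injective v : (forall w, b v w + a v * a w = 0) -> v = 0.
Proof.
move=> fv; have bvv : b v v = 0.
  by apply/eqP; rewrite -[_ == _](mulrn_eq0 _ 2) mulr2n {2}bA subrr.
have av : a v = 0.
  by have /eqP := fv v; rewrite bvv add0r mulf_eq0 orbb => /eqP.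
by apply: nondeg => // w; have := fv w; rewrite av mul0r addr0.
Qed.

(** A nonzero vector in the kernel of b, which exists in odd dimension,
    cannot be in the kernel of a, and can be rescaled. *)
Lemma reeb_exists : odd m -> exists v, (forall w, b v w = 0) /\ a v = 1.
Proof.
move=> /odd_antisymmetric_degenerate[v v0 bv].
have av : a v != 0 by apply: contraNneq v0 => av; apply/eqP/nondeg.
pose A : {scalar 'rV[R]_m} := HB.pack a (GRing.isLinear.Build _ _ _ _ _ aL).
exists ((a v)^-1 *: v); split; last by rewrite -[LHS]/(A _) linearZ /= mulVf.
move=> w; pose Ll : {scalar 'rV[R]_m} :=
  HB.pack (b^~ w) (GRing.isLinear.Build _ _ _ _ _ (bLl w)).
by rewrite -[LHS]/(Ll _) linearZ /= bv mulr0.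
Qed.

End ContactAlgebra.

(** * Changes of charts *)

Section Charts.
Context (R : realType) (T : topologicalType) (m : nat).
Variable S : smooth_structure R T m.
Implicit Types (a b c d : chart R T m) (x : T).

Lemma chart_image c y : (cmap c @` cdom c) y ->
  cdom c (cinv c y) /\ cmap c (cinv c y) = y.
Proof. by move=> [x cx <-]; rewrite (cmapK cx). Qed.

Lemma chart_image_open c (O : set T) : open O -> open (cmap c @` (cdom c `&` O)).
Proof.
move=> oO; rewrite openE => y [x [cx Ox] xy].
have cy : (cmap c @` cdom c) y by exists x.
have Oy : nbhs (cinv c y) O.
  by apply: open_nbhs_nbhs; split=> //; rewrite -xy (cmapK cx).
have n1 : \forall z \near y, O (cinv c z) := cinv_continuous cy Oy.
have n2 : nbhs y (cmap c @` cdom c) := open_nbhs_nbhs (conj (@cimage_open _ _ _ c) cy).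
change (nbhs y (cmap c @` (cdom c `&` O))).
apply: filterS (filterI n1 n2) => z [Oz /chart_image[cz zE]].
by exists (cinv c z).
Qed.

Lemma near_chart c x (O : set T) : cdom c x -> open O -> O x ->
  \forall y \near cmap c x, cdom c (cinv c y) /\ O (cinv c y).
Proof.
move=> cx oO Ox.
have : nbhs (cmap c x) (cmap c @` (cdom c `&` O)).
  by apply: open_nbhs_nbhs; split; [exact: chart_image_open|exists x].
by apply: filterS => _ [z [cz Oz] <-]; rewrite (cmapK cz).
Qed.

Lemma atlas_chart_at x : atlas S (chart_at S x).
Proof. by rewrite /chart_at; case: cid => c []. Qed.

Lemma cdom_chart_at x : cdom (chart_at S x) x.
Proof. by rewrite /chart_at; case: cid => c []. Qed.

Lemma transition_differentiable a b x : atlas S a -> atlas S b ->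
  cdom a x -> cdom b x -> differentiable (cmap b \o cinv a) (cmap a x).
Proof.
move=> Sa Sb ax bx; have [+ _] := atlas_compatible Sa Sb 1%N.
by apply; exists x.
Qed.

(** All comparisons between the charts a and b come from this chain rule
    for g o a^-1 = (g o b^-1) o (b o a^-1), which holds near the point. *)
Lemma diff_change_chart (W : normedModType R) (g : T -> W) a b x u :
  atlas S a -> atlas S b -> cdom a x -> cdom b x ->
  differentiable (g \o cinv b) (cmap b x) ->
  differentiable (g \o cinv a) (cmap a x) /\
  'd (g \o cinv a) (cmap a x) u =
  'd (g \o cinv b) (cmap b x) ('d (cmap b \o cinv a) (cmap a x) u).
Proof.
move=> Sa Sb ax bx gd.
have td := transition_differentiable Sa Sb ax bx.
have tx : (cmap b \o cinv a) (cmap a x) = cmap b x by rewrite /= (cmapK ax).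
have gd' : differentiable (g \o cinv b) ((cmap b \o cinv a) (cmap a x)).
  by rewrite tx.
have cd := differentiable_comp td gd'.
have E : {near cmap a x, ((g \o cinv b) \o (cmap b \o cinv a)) =1 (g \o cinv a)}.
  apply: filterS (near_chart ax (@cdom_open _ _ _ b) bx) => y [ay biy].
  by rewrite /= (cmapK biy).
have [d1 d2] := near_eq_diff E cd; split; first exact: d1.
apply: (etrans (congr1 (@^~ u) d2)).
apply: (etrans (diffcE u td gd')).
by rewrite tx.
Qed.

Lemma diff_transition_id a x u : cdom a x ->
  'd (cmap a \o cinv a) (cmap a x) u = u.
Proof.
move=> ax.
have E : {near cmap a x, idfun =1 (cmap a \o cinv a)}.
  apply: filterS (open_nbhs_nbhs (conj (@cimage_open _ _ _ a) _)) => [y /chart_image[_]//|].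
  by exists x.
have d1 : differentiable (idfun : 'rV[R]_m -> 'rV[R]_m) (cmap a x) by exact: ex_diff.
have [_ d2] := near_eq_diff E d1.
apply: (etrans (congr1 (@^~ u) d2)).
exact: (congr1 (@^~ u) (@diff_val _ _ _ _ _ _ _ (is_diff_id (cmap a x)))).
Qed.

Lemma tvecK c x (u : 'rV[R]_m) : atlas S c -> cdom c x -> tcoord c (tvec S c x u) = u.
Proof.
move=> Sc cx; have Sa := atlas_chart_at x; have ax := cdom_chart_at x.
have td := transition_differentiable Sa Sc ax cx.
have [_ E] := diff_change_chart u Sc Sa cx ax td.
by rewrite /tcoord /tvec -[LHS]E diff_transition_id.
Qed.

Lemma tcoordK c x (v : tangent S x) : atlas S c -> cdom c x -> tvec S c x (tcoord c v) = v.
Proof.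
move=> Sc cx; have Sa := atlas_chart_at x; have ax := cdom_chart_at x.
have td := transition_differentiable Sc Sa cx ax.
have [_ E] := diff_change_chart v Sa Sc ax cx td.
by rewrite /tcoord /tvec -[LHS]E diff_transition_id.
Qed.

Lemma tcoord0 c x : tcoord c (0 : tangent S x) = 0.
Proof. exact: linear0. Qed.

Lemma tvec_linear c x : linear (tvec S c x).
Proof. by move=> k u v; rewrite /tvec linearP. Qed.

Lemma differentialE (f : T -> R) c x (v : tangent S x) : smooth_function S f ->
  atlas S c -> cdom c x ->
  differential f v = 'd (f \o cinv c : _ -> R^o) (cmap c x) (tcoord c v).
Proof.
move=> fS Sc cx; have Sa := atlas_chart_at x; have ax := cdom_chart_at x.
have fd : differentiable (f \o cinv c : _ -> R^o) (cmap c x).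
  by have [+ _] := fS c Sc 1%N; apply; exists x.
by have [_] := diff_change_chart v Sa Sc ax cx fd.
Qed.

Section OneForm.
Variable eta : forall x, tangent S x -> R.
Hypothesis etaS : smooth_one_form eta.

Lemma local_form_scalar c y : scalar (local_form eta c y).
Proof.
by move=> k u v; rewrite /local_form tvec_linear (proj1 etaS).
Qed.

Lemma local_form_cmap c x u : cdom c x ->
  local_form eta c (cmap c x) u = eta (tvec S c x u).
Proof. by move=> cx; rewrite /local_form (cmapK cx). Qed.

Lemma local_formE c x (v : tangent S x) : atlas S c -> cdom c x ->
  eta v = local_form eta c (cmap c x) (tcoord c v).
Proof. by move=> Sc cx; rewrite local_form_cmap// tcoordK. Qed.

(** The expression of eta in the chart a is the pull-back of its expression
    in c by the change of charts. *)
Lemma local_form_change a c y u : atlas S a -> atlas S c ->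
  (cmap a @` (cdom a `&` cdom c)) y ->
  local_form eta a y u =
  local_form eta c ((cmap c \o cinv a) y) ('d (cmap c \o cinv a) y u).
Proof.
move=> Sa Sc [x [ax cx] <-]; rewrite /= (cmapK ax) !local_form_cmap//.
congr (eta _).
have Sb := atlas_chart_at x; have bx := cdom_chart_at x.
have td := transition_differentiable Sc Sb cx bx.
by have [_] := diff_change_chart u Sa Sc ax cx td.
Qed.

(** The exterior derivative at x, defined by the preferred chart at x, is
    computed by any chart around x. *)
Lemma ext_derivE c x (v w : tangent S x) : atlas S c -> cdom c x ->
  ext_deriv eta v w =
  extd (local_form eta c) (cmap c x) (tcoord c v) (tcoord c w).
Proof.
move=> Sc cx; have Sa := atlas_chart_at x; have ax := cdom_chart_at x.
pose a := chart_at S x.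
have tx : (cmap c \o cinv a) (cmap a x) = cmap c x by rewrite /= (cmapK ax).
rewrite -[in RHS]tx; apply: (@extd_pullback R m (cmap a @` (cdom a `&` cdom c))
  (cmap c @` cdom c)).
- exact: chart_image_open (@cdom_open _ _ _ c).
- exact: cimage_open.
- by move=> _ [z [az cz] <-]; exists z => //=; rewrite (cmapK az).
- exact: (atlas_compatible Sa Sc).
- by move=> z _; exact: local_form_scalar.
- by move=> u; exact: (proj2 etaS c Sc).
- by move=> z u zI; exact: local_form_change.
- by exists x.
Qed.

End OneForm.

End Charts.

(** * Differential forms in coordinates *)

Section LocalForms.
Context (R : realType) (m : nat).
Variables (U : set 'rV[R]_m) (e : 'rV[R]_m -> 'rV[R]_m -> R).
Hypotheses (oU : open U) (eL : forall z, U z -> scalar (e z)).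
Hypothesis eS : forall u, smooth_on U (fun z => e z u : R^o).

Let ed z u : U z -> differentiable (fun z => e z u : R^o) z.
Proof. by have [+ _] := eS u 1%N; exact. Qed.

Lemma extdN z v w : extd e z v w = - extd e z w v.
Proof. by rewrite /extd opprB. Qed.

Lemma extd_sum z v w : U z -> extd e z v w =
  \sum_j (w ord0 j * 'd (fun z => e z (delta_mx ord0 j) : R^o) z v -
          v ord0 j * 'd (fun z => e z (delta_mx ord0 j) : R^o) z w).
Proof.
move=> Uz.
have lin a b := diff_form_sum b a oU Uz eL (fun w => ed w Uz).
apply: (etrans (congr2 (fun p q : R => p - q) (lin _ _) (lin _ _))).
by rewrite -sumrB.
Qed.

Lemma extd_scalarr z v : U z -> scalar (extd e z v).
Proof.
move=> Uz a w w'; rewrite !extd_sum// mulr_sumr -big_split; apply: eq_bigr => j _ /=.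
pose D : {linear 'rV[R]_m -> R^o} := 'd (fun z => e z (delta_mx ord0 j) : R^o) z.
rewrite !mxE.
have -> : 'd (fun z => e z (delta_mx ord0 j) : R^o) z (a *: w + w') = a * D w + D w'.
  exact: (linearP D).
change ((a * w ord0 j + w' ord0 j) * D v - v ord0 j * (a * D w + D w') =
  a * (w ord0 j * D v - v ord0 j * D w) + (w' ord0 j * D v - v ord0 j * D w')).
rewrite !mulrBr mulrDl mulrDr opprD addrACA !mulrA.
by rewrite [v ord0 j * a]mulrC.
Qed.

Lemma extd_scalarl z w : U z -> scalar (fun v => extd e z v w).
Proof.
move=> Uz a v v'; rewrite /= !(extdN _ _ w).
by rewrite extd_scalarr// opprD mulrN.
Qed.

(** The value of e on a moving vector w at a moving point z: a sum of
    coordinates of w times components of e. *)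
Lemma Cdiff_form (V : normedModType R) k (O : set V) (z w : V -> 'rV[R]_m) :
  open O -> (forall y, O y -> U (z y)) -> Cdiff k O z -> Cdiff k O w ->
  Cdiff k O (fun y => e (z y) (w y) : R^o).
Proof.
move=> oO zU zS wS.
have /(Cdiff_eq oO) : forall y, O y ->
    \sum_j w y ord0 j * e (z y) (delta_mx ord0 j) = e (z y) (w y).
  by move=> y Oy; exact: (esym (form_sum _ (eL (zU y Oy)))).
apply; apply: (@Cdiff_sumr R V k O _ _ _ _ oO) => j _; apply: (Cdiff_mul oO).
  exact: Cdiff_coord.
exact: (Cdiff_comp_scalar oO zU zS (eS _ k)).
Qed.

End LocalForms.

(** By bilinearity the exterior derivative is a combination of the partial
    derivatives of the components of e, each of which is linear in one more
    vector and so falls under [Cdiff_form]. *)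
Lemma Cdiff_extd (R : realType) (m : nat) (U : set 'rV[R]_m)
    (e : 'rV[R]_m -> 'rV[R]_m -> R) (V : normedModType R) k (O : set V)
    (z v w : V -> 'rV[R]_m) :
  open U -> (forall z, U z -> scalar (e z)) ->
  (forall u, smooth_on U (fun z => e z u : R^o)) ->
  open O -> (forall y, O y -> U (z y)) ->
  Cdiff k O z -> Cdiff k O v -> Cdiff k O w ->
  Cdiff k O (fun y => extd e (z y) (v y) (w y) : R^o).
Proof.
move=> oU eL eS oO zU zS vS wS.
have /(Cdiff_eq oO) := fun y (Oy : O y) => esym (extd_sum oU eL eS (v y) (w y) (zU y Oy)).
pose E j z u : R := 'd (fun z => e z (delta_mx ord0 j) : R^o) z u.
have EL j z' : U z' -> scalar (E j z').
  move=> _; exact: (linearP ('d (fun z => e z (delta_mx ord0 j) : R^o) z')).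
have ES j u : smooth_on U (fun z => E j z u : R^o).
  by move=> l; have [_ /(_ u)] := eS (delta_mx ord0 j) l.+1.
have EC j (u : V -> 'rV[R]_m) : Cdiff k O u ->
    Cdiff k O (fun y => E j (z y) (u y) : R^o).
  by move=> uS; exact: (Cdiff_form (EL j) (ES j) oO zU zS uS).
apply; apply: (@Cdiff_sumr R V k O _ _ _ _ oO) => j _; apply: (Cdiff_add oO).
  apply: (Cdiff_mul oO); [exact: Cdiff_coord|exact: EC].
apply: (Cdiff_opp oO); apply: (Cdiff_mul oO); [exact: Cdiff_coord|exact: EC].
Qed.

(** * Contact manifolds *)

(** The map flat in coordinates, for the 1-form e. *)
Definition flat_form (R : realType) (m : nat)
    (e : 'rV[R]_m -> 'rV[R]_m -> R) (y v w : 'rV[R]_m) : R :=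
  extd e y v w + e y v * e y w.

Section OneForm.
Context (R : realType) (T : topologicalType) (m : nat).
Variable S : smooth_structure R T m.
Variable eta : forall x, tangent S x -> R.
Hypothesis etaS : smooth_one_form eta.
Implicit Types (c : chart R T m) (x : T).

Lemma local_form_smooth c u : atlas S c ->
  smooth_on (cmap c @` cdom c) (fun y => local_form eta c y u : R^o).
Proof. by move=> Sc; exact: (proj2 etaS c Sc). Qed.

Let chart_at_image x : (cmap (chart_at S x) @` cdom (chart_at S x)) (cmap (chart_at S x) x).
Proof. by exists x => //; exact: cdom_chart_at. Qed.

Lemma ext_deriv_scalarr x (v : tangent S x) : scalar (ext_deriv eta v).
Proof.
apply: (extd_scalarr (@cimage_open _ _ _ (chart_at S x))) (chart_at_image x) => [z _|u].
  exact: local_form_scalar.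
exact/local_form_smooth/atlas_chart_at.
Qed.

Lemma ext_derivN x (v w : tangent S x) : ext_deriv eta v w = - ext_deriv eta w v.
Proof. exact: extdN. Qed.

Lemma ext_deriv_scalarl x (w : tangent S x) : scalar (fun v => ext_deriv eta v w).
Proof.
move=> a v v'; rewrite /= !(ext_derivN _ w).
by rewrite ext_deriv_scalarr opprD mulrN.
Qed.

End OneForm.

Section Contact.
Context (R : realType) (P : topologicalType) (n : nat).
Variable S : smooth_structure R P (1 + n * 2).
Variable eta : forall x, tangent S x -> R.
Hypothesis etaC : contact_form eta.
Let etaS : smooth_one_form eta := proj1 etaC.

(** This expresses flat near a point in one chart, whereas its definition uses
    a chart depending on the point. *)
Lemma flatE (c : chart R P (1 + n * 2)) x (v w : tangent S x) : atlas S c -> cdom c x ->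
  flat eta v w = flat_form (local_form eta c) (cmap c x) (tcoord c v) (tcoord c w).
Proof.
move=> Sc cx; rewrite /flat /flat_form (ext_derivE etaS v w Sc cx).
by rewrite !(local_formE eta _ Sc cx).
Qed.

Lemma flat_scalarr x (v : tangent S x) : scalar (flat eta v).
Proof.
move=> a w w'; rewrite /flat (ext_deriv_scalarr etaS) (proj1 etaS).
move: (ext_deriv eta v w) (ext_deriv eta v w') (eta v) (eta w) (eta w').
by move=> *; ring.
Qed.

Lemma flat_scalarl x (w : tangent S x) : scalar (fun v => flat eta v w).
Proof.
move=> a v v'; rewrite /flat (ext_deriv_scalarl etaS) (proj1 etaS).
move: (ext_deriv eta v w) (ext_deriv eta v' w) (eta v) (eta v') (eta w).
by move=> *; ring.
Qed.

(** A vector in the radicals of eta and d eta is in the radical of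
    the volume form. *)
Lemma contact_nondegenerate x (v : tangent S x) :
  eta v = 0 -> (forall w, ext_deriv eta v w = 0) -> v = 0.
Proof.
move=> ev dv; apply/eqP; apply: contraT => v0.
have [w] := proj2 etaC x; apply: contraNT => _; apply/eqP; move: w.
pose a1 : Defs.form R 1 (tangent S x) := fun v => eta (v ord0).
pose a2 : Defs.form R 2 (tangent S x) := fun v => ext_deriv eta (v ord0) (v ord_max).
apply: (@top_form_radical R (1 + n * 2) (wedge a1 (wedge_power a2 n)) v) => //.
- apply: wedge_multilinear.
    move=> w i k u u'; rewrite /a1 /update (ord1 i) eqxx; exact: (proj1 etaS).
  apply: wedge_power_multilinear => w i k u u'; rewrite /a2 /update.
  case: (ord0 =P i) => [<-|/eqP i0] /=; first exact: (ext_deriv_scalarl etaS).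
  have -> : ord_max == i by case: i i0 => [[|[|]]].
  exact: (ext_deriv_scalarr etaS).
- by move=> w i j; exact: wedge_alternating.
apply: wedge_radical => [w i|]; first by rewrite (ord1 i) /a1 => ->.
apply: wedge_power_radical => w i; rewrite /a2.
case: (ord0 =P i) => [<- ->|/eqP i0]; first exact: dv.
have -> : i = ord_max by apply/val_inj; case: i i0 => [[|[|]]].
by move=> ->; rewrite (ext_derivN eta) dv oppr0.
Qed.

Lemma flat_inj x (v : tangent S x) : (forall w, flat eta v w = 0) -> v = 0.
Proof.
exact: (flat_injective (ext_derivN eta (x:=x)) (@contact_nondegenerate x)).
Qed.

(** The epsilon operator in sharp picks some preimage of flat v, and flat is
    injective. *)
Lemma sharpP x (v : tangent S x) : sharp eta (flat eta v) = v.
Proof.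
rewrite /sharp; case: xgetP => [u _ /= uv|nv]; last by case: (nv v).
apply/eqP; rewrite -subr_eq0; apply/eqP/flat_inj => w.
have := flat_scalarl w (-1) v u; rewrite /= uv mulN1r addNr => <-.
by congr (flat eta _ w); rewrite scaleN1r addrC.
Qed.

Lemma reebP x : (forall w, ext_deriv eta (reeb eta x) w = 0) /\ eta (reeb eta x) = 1.
Proof.
have [|v vR] := @reeb_exists R (1 + n * 2) (eta (x:=x)) (ext_deriv eta (x:=x))
  (proj1 etaS x) (ext_deriv_scalarl etaS (x:=x)) (ext_deriv_scalarr etaS (x:=x))
  (ext_derivN eta (x:=x)) (@contact_nondegenerate x).
  by rewrite oddD oddM andbF.
by rewrite /reeb; case: xgetP => [u _ //|nv]; case: (nv v).
Qed.

Lemma flat_reeb x w : flat eta (reeb eta x) w = eta w.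
Proof. by have [d1 d2] := reebP x; rewrite /flat d1 d2 add0r mul1r. Qed.

Section Local.
Variable c : chart R P (1 + n * 2).
Hypothesis Sc : atlas S c.
Let U := cmap c @` cdom c.
Let oU : open U := @cimage_open _ _ _ c.
Let e := local_form eta c.

Let eL z : U z -> scalar (e z).
Proof. by move=> _; exact: local_form_scalar. Qed.

Let eS u : smooth_on U (fun z => e z u : R^o).
Proof. exact: local_form_smooth. Qed.

Lemma flat_form_scalarr y u : U y -> scalar (flat_form e y u).
Proof.
move=> Uy a w w'; rewrite /flat_form.
rewrite (extd_scalarr oU eL eS _ Uy) (eL Uy).
move: (extd e y u w) (extd e y u w') (e y u) (e y w) (e y w').
by move=> *; ring.
Qed.

Lemma flat_form_scalarl y w : U y -> scalar (fun u => flat_form e y u w).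
Proof.
move=> Uy a u u'; rewrite /flat_form.
rewrite (extd_scalarl oU eL eS _ Uy) (eL Uy).
move: (extd e y u w) (extd e y u' w) (e y u) (e y u') (e y w).
by move=> *; ring.
Qed.

Lemma flat_form_inj y u : U y -> (forall w, flat_form e y u w = 0) -> u = 0.
Proof.
move=> [x cx <-] fu; rewrite -(tvecK u Sc cx).
suff -> : tvec S c x u = 0 by exact: tcoord0.
apply: flat_inj => w.
by rewrite (flatE _ _ Sc cx) (tvecK u Sc cx).
Qed.

Lemma Cdiff_flat_form (V : normedModType R) k (O : set V)
    (z v w : V -> 'rV[R]_(1 + n * 2)) :
  open O -> (forall y, O y -> U (z y)) ->
  Cdiff k O z -> Cdiff k O v -> Cdiff k O w ->
  Cdiff k O (fun y => flat_form e (z y) (v y) (w y) : R^o).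
Proof.
move=> oO zU zS vS wS.
apply: (Cdiff_add oO); first exact: (Cdiff_extd oU eL eS oO zU zS vS wS).
by apply: (Cdiff_mul oO); exact: (Cdiff_form eL eS oO zU).
Qed.

End Local.

(** The Reeb field solves flat(R) = eta, a linear system with smooth
    coefficients. *)
Lemma smooth_reeb : smooth_vector_field (reeb eta).
Proof.
move=> c Sc k; have oU := @cimage_open _ _ _ c.
pose e := local_form eta c.
pose A y : 'M[R]_(1 + n * 2) :=
  \matrix_(i, j) flat_form e y (delta_mx ord0 i) (delta_mx ord0 j).
pose b y : 'rV[R]_(1 + n * 2) := \row_j e y (delta_mx ord0 j).
apply: (@Cdiff_solve R 'rV[R]_(1 + n * 2) _ k _ A b) => //.
- move=> i j; under eq_fun do rewrite mxE.
  apply: (Cdiff_flat_form Sc (z := id)) => //; try exact: Cdiff_cst.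
  exact: Cdiff_id.
- move=> j; under eq_fun do rewrite mxE.
  exact: local_form_smooth.
- move=> y Uy; apply: bilinear_unit.
  + by move=> w; exact: flat_form_scalarl.
  + by move=> w; exact: flat_form_scalarr.
  + by move=> v; exact: flat_form_inj.
move=> _ [x cx <-]; rewrite (cmapK cx); apply/rowP => j; rewrite [RHS]mxE.
have Uy : (cmap c @` cdom c) (cmap c x) by exists x.
have := bilinear_matrix (fun w => flat_form_scalarl Sc w Uy)
  (fun w => flat_form_scalarr Sc w Uy) (tcoord c (reeb eta x)) (delta_mx ord0 j).
rewrite trmx_delta -colE [RHS]mxE => <-.
rewrite -[in LHS](tvecK (S:=S) (delta_mx ord0 j) Sc cx) -flatE// flat_reeb.
by rewrite (local_formE eta _ Sc cx) tvecK.
Qed.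

End Contact.

(** * Constrained Hamiltonian systems *)

Section TangentMap.
Context (R : realType) (N P : topologicalType) (k m : nat).
Variables (SN : smooth_structure R N k) (SP : smooth_structure R P m).
Variable f : N -> P.

Lemma tmap_linear x : linear (@tmap R N P k m SN SP f x).
Proof. by move=> a u v; rewrite /tmap linearP. Qed.

Hypothesis fS : smooth_map SN SP f.

Lemma smooth_map_differentiable c d x : atlas SN c -> atlas SP d ->
  cdom c x -> cdom d (f x) -> differentiable (cmap d \o f \o cinv c) (cmap c x).
Proof.
move=> Sc Sd cx dx; have [+ _] := proj2 fS c d Sc Sd 1%N; apply.
by exists x.
Qed.

(** Both sides are derivatives of f; the preferred charts at x and at f x,
    through which the tangent map is defined, cancel by the chain rule. *)
Lemma tcoord_tmap c d x u : atlas SN c -> atlas SP d -> cdom c x -> cdom d (f x) ->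
  tcoord d (tmap SP f (tvec SN c x u)) = 'd (cmap d \o f \o cinv c) (cmap c x) u.
Proof.
move=> Sc Sd cx dx.
have Sa := atlas_chart_at SN x; have ax := cdom_chart_at SN x.
have Sb := atlas_chart_at SP (f x); have bx := cdom_chart_at SP (f x).
set a := chart_at SN x in Sa ax *; set b := chart_at SP (f x) in Sb bx *.
have [bcd E1] := diff_change_chart u Sc Sa cx ax (smooth_map_differentiable Sa Sb ax bx).
have td := transition_differentiable Sb Sd bx dx.
have bE : (cmap b \o f \o cinv c) (cmap c x) = cmap b (f x) by rewrite /= (cmapK cx).
have td' : differentiable (cmap d \o cinv b) ((cmap b \o f \o cinv c) (cmap c x)).
  by rewrite bE.
have E : {near cmap c x, (cmap d \o cinv b) \o (cmap b \o f \o cinv c) =1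
    (cmap d \o f \o cinv c)}.
  have oO : open (f @^-1` cdom b).
    by apply: open_comp (@cdom_open _ _ _ b) => y _; exact: (proj1 fS).
  apply: filterS (near_chart cx oO bx) => y [cy biy].
  by rewrite /= (cmapK biy).
have [_ E2] := near_eq_diff E (differentiable_comp bcd td').
apply/esym; apply: (etrans (congr1 (@^~ u) E2)).
apply: (etrans (diffcE u bcd td')).
by rewrite bE E1.
Qed.

End TangentMap.

Section ConstrainedSystem.
Context (R : realType) (n k : nat) (P : topologicalType).
Variable SP : smooth_structure R P (1 + n * 2).
Variable eta : forall p : P, tangent SP p -> R.
Hypothesis etaC : contact_form eta.
Variable H : P -> R.
Hypothesis HS : smooth_function SP H.
Variables (M : set P) (SM : smooth_structure R M k).
Hypothesis MP : embedded_submanifold SP SM.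
Variable F : forall x : M, {vspace tangent SP (val x)}.
Hypothesis FS : subbundle SM k F.
Hypothesis transversal : forall x : M,
     [set sharp eta alpha | alpha in annihilator (F x)] `&`
     range (fun v : tangent SM x => inclusion_tangent SP v) = [set 0].

Let etaS : smooth_one_form eta := proj1 etaC.
Let valS : smooth_map SM SP (val : M -> P) := proj1 MP.

Local Notation iota := (inclusion_tangent SP).

Lemma inclusion_linear x : linear (fun u : tangent SM x => iota u).
Proof. exact: tmap_linear. Qed.

(** Such a u satisfies flat(u) in the annihilator of F, so its image lies in
    the intersection of sharp(F^o) with the tangent space of M; the inclusion of M
    being an immersion, u itself vanishes. *)
Lemma transversal_injective (x : M) (u : tangent SM x) :
  (forall w, w \in F x -> flat eta (iota u) w = 0) -> u = 0.
Proof.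
move=> uF; apply: (proj2 MP x).
have i0 : iota (0 : tangent SM x) = 0 by exact: linear0.
have : [set 0] (iota u).
  rewrite -transversal; split; last by exists u.
  exists (flat eta (iota u)); last exact: sharpP.
  by split; [exact: flat_scalarr|].
by move=> /= iu; rewrite -[LHS]/(iota u) -[RHS]/(iota 0) iu i0.
Qed.

(** The 1-form which flat of the Hamiltonian vector field of H equals on an
    unconstrained contact manifold; here X only realises it on F. *)
Definition hamiltonian_form (x : P) (w : tangent SP x) : R :=
  differential H w - (H x + differential H (reeb eta x)) * eta w.

Lemma hamiltonian_form_scalar x : scalar (@hamiltonian_form x).
Proof.
move=> a w w'; rewrite /hamiltonian_form (proj1 etaS) /differential linearP /=.
set p := 'd _ _ w; set q := 'd _ _ w'; set r := 'd _ _ _.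
move: p q r (H x) (eta w) (eta w') => p q r h s t.
change (a * p + q - (h + r) * (a * s + t) =
  a * (p - (h + r) * s) + (q - (h + r) * t)).
by ring.
Qed.

Lemma solutionP (x : M) (u : tangent SM x) :
  annihilator (F x) (fun w : tangent SP (val x) =>
    flat eta (iota u) w - differential H w
    + (H (val x) + differential H (reeb eta (val x))) * eta w) <->
  forall w, w \in F x -> flat eta (iota u) w = hamiltonian_form w.
Proof.
have E w : flat eta (iota u) w - differential H w
    + (H (val x) + differential H (reeb eta (val x))) * eta w =
    flat eta (iota u) w - hamiltonian_form w.
  by rewrite /hamiltonian_form opprB addrA addrAC.
split=> [[_ uF] w wF|uF].
  by apply/eqP; rewrite -subr_eq0 -E; apply/eqP/uF.
split=> [a w w'|w wF]; last by rewrite E uF// subrr.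
rewrite /= !E (flat_scalarr etaC) hamiltonian_form_scalar.
move: (flat _ _ w) (flat _ _ w') (hamiltonian_form w) (hamiltonian_form w') => *.
by ring.
Qed.

Section Frame.
Variables (x : M) (c : chart R M k) (s : 'I_k -> tangent SP (val x)).
Hypotheses (Sc : atlas SM c) (cx : cdom c x).
Hypothesis sF : basis_of (F x) [seq s i | i <- enum 'I_k].

(** The pairing of the tangent space of M with F, in the coordinates given by
    a chart and a frame.  The frame has k members, so that it has a square matrix;
    this is where the equality of rank and dimension enters. *)
Definition frame_pairing (u w : 'rV[R]_k) : R :=
  flat eta (iota (tvec SM c x u)) (\sum_j w ord0 j *: s j).

Lemma frame_sum w : w \in F x -> exists a : 'rV[R]_k, w = \sum_j a ord0 j *: s j.
Proof.
move=> wF; have sF' : basis_of (F x) [tuple s i | i < k] by exact: sF.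
exists (\row_j coord [tuple s i | i < k] j w).
rewrite {1}(coord_basis sF' wF); apply: eq_bigr => j _.
by rewrite mxE -tnth_nth tnth_mktuple.
Qed.

Lemma frame_mem (a : 'rV[R]_k) : \sum_j a ord0 j *: s j \in F x.
Proof.
apply: memv_suml => j _; apply: memvZ; apply: (basis_mem sF).
by apply/mapP; exists j => //; exact: mem_enum.
Qed.

Lemma frame_linear (a : R) (w w' : 'rV[R]_k) :
  \sum_j (a *: w + w') ord0 j *: s j =
  a *: (\sum_j w ord0 j *: s j) + \sum_j w' ord0 j *: s j.
Proof.
rewrite scaler_sumr -big_split; apply: eq_bigr => j _ /=.
by rewrite !mxE scalerDl scalerA.
Qed.

Lemma frame_delta j : \sum_l (delta_mx ord0 j : 'rV[R]_k) ord0 l *: s l = s j.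
Proof.
rewrite (bigD1 j)//= mxE !eqxx scale1r big1 ?addr0// => l lj.
by rewrite mxE eqxx (negbTE lj) scale0r.
Qed.

Lemma frame_pairing_scalarl w : scalar (frame_pairing^~ w).
Proof.
move=> a u u'; rewrite /frame_pairing tvec_linear inclusion_linear.
exact: (flat_scalarl etaC).
Qed.

Lemma frame_pairing_scalarr u : scalar (frame_pairing u).
Proof.
move=> a w w'; rewrite /frame_pairing frame_linear.
exact: (flat_scalarr etaC).
Qed.

Lemma frame_pairing_inj u : (forall w, frame_pairing u w = 0) -> u = 0.
Proof.
move=> fu; rewrite -(tvecK (S:=SM) u Sc cx).
suff -> : tvec SM c x u = 0 by exact: tcoord0.
by apply: transversal_injective => w /frame_sum[a ->]; exact: fu.
Qed.

End Frame.

Lemma solution_exists (x : M) : exists u : tangent SM x,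
  forall w, w \in F x -> flat eta (iota u) w = hamiltonian_form w.
Proof.
have [V [oV Vx [s [_ sF]]]] := FS x.
have Sc := atlas_chart_at SM x; have cx := cdom_chart_at SM x.
pose sx i := s i x.
have al : scalar (fun a : 'rV[R]_k => hamiltonian_form (\sum_j a ord0 j *: sx j)).
  move=> a w w'; rewrite frame_linear.
  exact: hamiltonian_form_scalar.
have [u uE] := bilinear_surj (frame_pairing_scalarl (chart_at SM x) sx)
  (frame_pairing_scalarr (chart_at SM x) sx) (frame_pairing_inj Sc cx (sF x Vx)) al.
exists (tvec SM (chart_at SM x) x u) => w /(frame_sum (sF x Vx))[a ->].
exact: uE.
Qed.

Lemma solution_unique (x : M) (u u' : tangent SM x) :
  (forall w, w \in F x -> flat eta (iota u) w = hamiltonian_form w) ->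
  (forall w, w \in F x -> flat eta (iota u') w = hamiltonian_form w) -> u = u'.
Proof.
move=> uF uF'; apply/eqP; rewrite -subr_eq0; apply/eqP/transversal_injective => w wF.
have -> : u - u' = -1 *: u' + u by rewrite scaleN1r addrC.
rewrite inclusion_linear.
have := flat_scalarl etaC w (-1) (iota u') (iota u).
by rewrite /= uF// uF'// mulN1r addNr.
Qed.

(** On a neighbourhood O of any point the coordinates of X are the unique
    solution of the linear system with matrix A and right hand side b, which are
    written below in fixed charts and a fixed frame. *)
Lemma solution_smooth (X : forall x : M, tangent SM x) :
  (forall x w, w \in F x -> flat eta (iota (X x)) w = hamiltonian_form w) ->
  smooth_vector_field X.
Proof.
move=> XF c Sc l; apply: Cdiff_local => _ [x0 cx0 <-].
have [V [oV Vx0 [s [sS sF]]]] := FS x0.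
pose d := chart_at SP (val x0); have Sd : atlas SP d := atlas_chart_at SP (val x0).
have oW : open (V `&` val @^-1` cdom d : set M).
  apply: openI oV _; apply: open_comp (@cdom_open _ _ _ d) => y _.
  exact: (proj1 valS).
pose O := cmap c @` (cdom c `&` (V `&` val @^-1` cdom d)).
have oO : open O by exact: chart_image_open.
exists O; first by exists x0 => //; do 2 split=> //; exact: cdom_chart_at.
have Ox y : O y -> exists x : M,
    [/\ cdom c x, V x, cdom d (val x), cmap c x = y & cinv c y = x].
  by move=> [x [cx [Vx dx]] <-]; exists x; rewrite (cmapK cx).
(* z is the inclusion of M in coordinates; J i, Sj j and Rb (z y) are the
   coordinates, in the chart d of P, of the i-th coordinate vector of M, of the
   j-th member of the frame and of the Reeb field *)
pose z := cmap d \o val \o cinv c.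
have zS j : Cdiff j O z.
  apply: (Cdiff_sub _ (proj2 valS c d Sc Sd j)).
  by move=> _ [x [cx [_ dx]] <-]; exists x.
pose U := cmap d @` cdom d.
have zU y : O y -> U (z y).
  by move=> /Ox[x [cx _ dx _ yx]]; exists (val x); rewrite // /z /= yx.
pose e := local_form eta d.
pose J i y := 'd z y (delta_mx ord0 i).
have JS i : Cdiff l O (J i) by have [_] := zS l.+1; exact.
pose Sj j y := tcoord d (s j (cinv c y)).
have SjS j : Cdiff l O (Sj j).
  apply: (Cdiff_sub _ (sS j c d Sc Sd l)).
  by rewrite /O setIA.
pose Rb y := tcoord d (reeb eta (cinv d y)).
have RbS : Cdiff l O (fun y => Rb (z y)).
  apply: (Cdiff_comp oO (@cimage_open _ _ _ d) zU (zS l)).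
  exact: (smooth_reeb etaC Sd).
pose h := H \o cinv d : _ -> R^o.
have hS : smooth_on U h := HS Sd.
pose dh y u : R := 'd h y u.
have dhS (w : 'rV[R]_k -> 'rV[R]_(1 + n * 2)) : Cdiff l O w ->
    Cdiff l O (fun y => dh (z y) (w y) : R^o).
  have dhL y : U y -> scalar (dh y) by move=> _; exact: (linearP ('d h y)).
  have dhU u : smooth_on U (fun y => dh y u : R^o).
    by move=> j; have [_] := hS j.+1; exact.
  exact: (Cdiff_form dhL dhU oO zU (zS l)).
have eS (w : 'rV[R]_k -> 'rV[R]_(1 + n * 2)) : Cdiff l O w ->
    Cdiff l O (fun y => e (z y) (w y) : R^o).
  have eL y : U y -> scalar (e y) by move=> _; exact: local_form_scalar.
  have eU u : smooth_on U (fun y => e y u : R^o) by exact: local_form_smooth.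
  exact: (Cdiff_form eL eU oO zU (zS l)).
pose A y : 'M[R]_k := \matrix_(i, j) flat_form e (z y) (J i y) (Sj j y).
pose b y : 'rV[R]_k :=
  \row_j (dh (z y) (Sj j y) - (h (z y) + dh (z y) (Rb (z y))) * e (z y) (Sj j y)).
have AE x : cdom c x -> V x -> cdom d (val x) ->
    A (cmap c x) = \matrix_(i, j)
      frame_pairing c (s^~ x) (delta_mx ord0 i) (delta_mx ord0 j).
  move=> cx Vx dx; apply/matrixP => i j; rewrite !mxE /frame_pairing frame_delta.
  rewrite (flatE etaC _ _ Sd dx) (tcoord_tmap valS _ Sc Sd cx dx).
  by rewrite /z /Sj /= (cmapK cx).
apply: (@Cdiff_solve R 'rV[R]_k k l O A b) => //.
- move=> i j; under eq_fun do rewrite mxE.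
  exact: (Cdiff_flat_form etaC Sd oO zU (zS l) (JS i) (SjS j)).
- move=> j; under eq_fun do rewrite mxE.
  apply: (Cdiff_add oO (dhS _ (SjS j))); apply: (Cdiff_opp oO).
  apply: (Cdiff_mul oO); last exact: eS.
  apply: (Cdiff_add oO); last exact: dhS.
  exact: (Cdiff_comp_scalar oO zU (zS l) (hS l)).
- move=> y /Ox[x [cx Vx dx <- _]]; rewrite AE//; apply: bilinear_unit.
  + exact: frame_pairing_scalarl.
  + exact: frame_pairing_scalarr.
  + exact: (frame_pairing_inj Sc cx (sF x Vx)).
move=> y /Ox[x [cx Vx dx <- ->]]; rewrite AE//; apply/rowP => j.
have := bilinear_matrix (frame_pairing_scalarl c (s^~ x))
  (frame_pairing_scalarr c (s^~ x)) (tcoord c (X x)) (delta_mx ord0 j).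
rewrite trmx_delta -colE [RHS]mxE => <-.
rewrite /frame_pairing frame_delta (tcoordK _ Sc cx) XF; last first.
  by rewrite -(frame_delta (s^~ x)); exact: (frame_mem (sF x Vx)).
rewrite /hamiltonian_form mxE /z /Sj /Rb /h /= (cmapK cx) (cmapK dx).
by rewrite !(differentialE _ HS Sd dx) (local_formE eta _ Sd dx).
Qed.

End ConstrainedSystem.

Theorem corollary1 (R : realType) (n k r : nat) (P : topologicalType)
  (SP : smooth_structure R P (1 + n * 2))
  (eta : forall p : P, tangent SP p -> R) (eta_contact : contact_form eta)
  (H : P -> R) (H_smooth : smooth_function SP H)
  (M : set P) (SM : smooth_structure R M k)
  (M_embedded : embedded_submanifold SP SM)
  (F : forall x : M, {vspace tangent SP (val x)})
  (F_subbundle : subbundle SM r F)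
  (rankF : r = k)
  (transversal : forall x : M,
     [set sharp eta alpha | alpha in annihilator (F x)] `&`
     range (fun v : tangent SM x => inclusion_tangent SP v) = [set 0]) :
  exists! X : (forall x : M, tangent SM x),
    smooth_vector_field X /\
    forall x : M,
      annihilator (F x) (fun w : tangent SP (val x) =>
        flat eta (inclusion_tangent SP (X x)) w - differential H w
        + (H (val x) + differential H (reeb eta (val x))) * eta (val x) w).
Proof.
subst r.
have [X XF] : exists X : (forall x : M, tangent SM x), forall x w, w \in F x ->
    flat eta (inclusion_tangent SP (X x)) w = hamiltonian_form eta H w.
  have ex := solution_exists eta_contact H M_embedded F_subbundle transversal.
  by exists (fun x => projT1 (cid (ex x))) => x; exact: (projT2 (cid (ex x))).
exists X; split.
  split; last by move=> x; apply/(solutionP eta_contact); exact: XF.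
  exact: (solution_smooth eta_contact H_smooth M_embedded F_subbundle transversal).
move=> Y [_ YF]; apply: functional_extensionality_dep => x.
apply: (solution_unique eta_contact M_embedded transversal (XF x)) => w wF.
by have /(solutionP eta_contact) YFx := YF x; exact: YFx.
Qed.
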